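(* Let $u,w\in\mathbb{D}$ and $B(z)=\left(\frac{z-w}{1-\overline{w}z}\right)\left(\frac{z-u}{1-\overline{u}z}\right)$, let $c$ be the unique critical point of $B$ in $\mathbb{D}$, and let \[ \lambda=\exp\!\left[i\left(\pi+2\arg(1-\overline{c}w)+2\arg(1-\overline{c}u)+2\arg(1-c\overline{B(c)})\right)\right]\left(\frac{B(c)-c}{1-\overline{c}B(c)}\right). \] Then $B$ is elliptic, parabolic or hyperbolic respectively if and only if $\lambda$ lies in $\mathcal{E}_2$, in the relative boundary of $\mathcal{E}_2$ in $\mathbb{D}$, or in $\mathbb{D}\setminus\overline{\mathcal{E}_2}$, respectively.
   Context: $\mathbb{D}$ denotes the open unit disk. By the Denjoy–Wolff theorem, a finite Blaschke product $B$ of degree at least $2$ has a unique point $z_0\in\overline{\mathbb{D}}$ (its Denjoy–Wolff point) such that $B^n(z)\to z_0$ for every $z\in\mathbb{D}$. $B$ is called elliptic if $z_0\in\mathbb{D}$; hyperbolic if $z_0\in\partial\mathbb{D}$ and $B'(z_0)<1$; parabolic if $z_0\in\partial\mathbb{D}$ and $B'(z_0)=1$. $\mathcal{E}_2$ is the set of $w\in\mathbb{D}$ for which $\left(\frac{z-w}{1-\overline{w}z}\right)^2$ is elliptic. The quantities $\exp(2i\arg(\cdot))$ do not depend on the choice of branch of $\arg$. *)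

(* Defs.v *)
From Stdlib Require Import Reals.
From Coquelicot Require Export Coquelicot.
Open Scope R_scope.
Open Scope C_scope.

Definition disk (z : C) : Prop := (Cmod z < 1)%R.

Definition cis (t : R) : C := (cos t, sin t).

Definition bfac (a z : C) : C := (z - a) / (1 - Cconj a * z).

Definition cderiv (f : C -> C) (z l : C) : Prop :=
  @is_derive C_AbsRing C_NormedModule f z l.

Definition DW_point (B : C -> C) (z0 : C) : Prop :=
  (Cmod z0 <= 1)%R /\
  forall z, disk z ->
    filterlim (fun n : nat => Nat.iter n B z) eventually (locally z0).

Definition elliptic (B : C -> C) : Prop :=
  exists z0, DW_point B z0 /\ disk z0.

Definition hyperbolic (B : C -> C) : Prop :=
  exists z0, DW_point B z0 /\ Cmod z0 = 1%R /\
    exists d : C, cderiv B z0 d /\ snd d = 0%R /\ (fst d < 1)%R.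

Definition parabolic (B : C -> C) : Prop :=
  exists z0, DW_point B z0 /\ Cmod z0 = 1%R /\ cderiv B z0 (RtoC 1).

Definition E2 (w : C) : Prop :=
  disk w /\ elliptic (fun z => bfac w z * bfac w z).

Definition closureC (S : C -> Prop) (z : C) : Prop :=
  forall eps : R, (0 < eps)%R -> exists y, S y /\ (Cmod (y - z) < eps)%R.

Definition rel_closure (D S : C -> Prop) (z : C) : Prop :=
  D z /\ forall eps : R, (0 < eps)%R ->
    exists y, D y /\ S y /\ (Cmod (y - z) < eps)%R.

Definition rel_interior (D S : C -> Prop) (z : C) : Prop :=
  D z /\ exists eps : R, (0 < eps)%R /\
    forall y, D y -> (Cmod (y - z) < eps)%R -> S y.

Definition rel_boundary (D S : C -> Prop) (z : C) : Prop :=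
  rel_closure D S z /\ ~ rel_interior D S z.

(* Main.v *)
Require Import Defs.
From Stdlib Require Import Reals Lra Lia Psatz Classical.
From Coquelicot Require Import Coquelicot.
Open Scope R_scope.
Open Scope C_scope.

(** A degree two Blaschke product [B] with critical point [c] satisfies
    [bfac (B c) o B = e (bfac c)^2] with [|e| = 1]; hence the automorphism
    [psi = k bfac (B c)], for a suitable unimodular [k], conjugates [B] to
    [(bfac (psi c))^2], and [lambda = psi c].  It remains to classify the maps
    [(bfac l)^2].  Their fixed points are the roots of a self-inversive cubic
    whose discriminant is a positive multiple of
    [8 Re l + 1 + 18 |l|^2 - 27 |l|^4]: its sign separates a fixed point in the
    disk (+), a boundary fixed point with derivative 1 (0), and a boundary fixed
    point with derivative less than 1 (-).  Convergence of all orbits follows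
    from the Schwarz-Pick contraction in the first case, and from the growth of
    the Poisson kernel along orbits (Julia's lemma) in the other two.  As the
    discriminant is continuous and, for fixed [|l|], strictly increasing in
    [Re l], its zero set in the disk is the relative boundary of its positivity set. *)

(** * Complex continuity and derivatives *)

(** [C] carries two uniform structures: the product one behind [locally] in [DW_point], and this
    one, whose balls are discs for [Cmod]. [locally_C] passes between them. *)
Notation CU := (AbsRing_UniformSpace C_AbsRing).

Definition ccont (f : C -> C) (z : C) : Prop := @continuous CU CU f z.

Definition near (z : C) (P : C -> Prop) : Prop :=
  exists d : R, (0 < d)%R /\ forall y, (Cmod (y - z) < d)%R -> P y.

Lemma near_locally (z : C) (P : C -> Prop) : near z P <-> @locally CU z P.
Proof.
  split.
  - intros [d [Hd H]]. exists (mkposreal d Hd). exact H.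
  - intros [d H]. exists d. split; [apply cond_pos | exact H].
Qed.

Lemma near_and (z : C) (P Q : C -> Prop) :
  near z P -> near z Q -> near z (fun y => P y /\ Q y).
Proof.
  rewrite !near_locally. apply filter_and.
Qed.

Lemma near_imp (z : C) (P Q : C -> Prop) :
  (forall y, P y -> Q y) -> near z P -> near z Q.
Proof. rewrite !near_locally. apply filter_imp. Qed.

Lemma ccont_near (f : C -> C) (z : C) :
  ccont f z <-> forall eps : R, (0 < eps)%R -> near z (fun y => Cmod (f y - f z) < eps)%R.
Proof.
  split.
  - intros H eps He. rewrite near_locally.
    apply (H (fun y => Cmod (y - f z) < eps)%R).
    exists (mkposreal eps He). now intros.
  - intros H P [eps HP]. apply near_locally.
    apply (near_imp _ (fun y => Cmod (f y - f z) < eps)%R).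
    + intros y Hy. now apply HP.
    + apply H, cond_pos.
Qed.

Lemma ccont_preimage (f : C -> C) (z : C) (P : C -> Prop) :
  ccont f z -> near (f z) P -> near z (fun y => P (f y)).
Proof.
  intros H HP. apply near_locally. apply H. now apply near_locally.
Qed.

Lemma ccont_id (z : C) : ccont (fun y => y) z.
Proof. exact (@continuous_id CU z). Qed.

Lemma ccont_const (a z : C) : ccont (fun _ => a) z.
Proof. exact (@continuous_const CU CU a z). Qed.

Lemma ccont_plus (f g : C -> C) (z : C) :
  ccont f z -> ccont g z -> ccont (fun y => f y + g y) z.
Proof.
  intros Hf Hg.
  exact (@continuous_plus CU C_AbsRing (AbsRing_NormedModule C_AbsRing) f g z Hf Hg).
Qed.

Lemma ccont_mult (f g : C -> C) (z : C) :
  ccont f z -> ccont g z -> ccont (fun y => f y * g y) z.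
Proof. intros Hf Hg. exact (@continuous_mult CU C_AbsRing f g z Hf Hg). Qed.

Lemma ccont_opp (f : C -> C) (z : C) : ccont f z -> ccont (fun y => - f y) z.
Proof.
  intros Hf.
  exact (@continuous_opp CU C_AbsRing (AbsRing_NormedModule C_AbsRing) f z Hf).
Qed.

Lemma ccont_minus (f g : C -> C) (z : C) :
  ccont f z -> ccont g z -> ccont (fun y => f y - g y) z.
Proof. intros Hf Hg. apply (ccont_plus f (fun y => - g y)); auto using ccont_opp. Qed.

Lemma ccont_comp (f g : C -> C) (z : C) :
  ccont f z -> ccont g (f z) -> ccont (fun y => g (f y)) z.
Proof. intros Hf Hg. exact (@continuous_comp CU CU CU f g z Hf Hg). Qed.

Lemma near_neq_0 (z : C) : z <> 0 -> near z (fun y => y <> 0).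
Proof.
  intros Hz. exists (Cmod z). split; [now apply Cmod_gt_0|].
  intros y Hy ->. replace (0 - z) with (- z) in Hy by ring.
  rewrite Cmod_opp in Hy. lra.
Qed.

Lemma ccont_Cinv (z : C) : z <> 0 -> ccont Cinv z.
Proof.
  intros Hz. apply ccont_near. intros eps He.
  assert (Hm := proj1 (Cmod_gt_0 z) Hz).
  exists (Rmin (Cmod z / 2) (eps * Cmod z * Cmod z / 2)). split.
  { apply Rmin_pos; [lra|]. apply Rdiv_lt_0_compat; [|lra].
    repeat apply Rmult_lt_0_compat; lra. }
  intros y Hy.
  assert (H1 : (Cmod (y - z) < Cmod z / 2)%R)
    by (eapply Rlt_le_trans; [exact Hy | apply Rmin_l]).
  assert (H2 : (Cmod (y - z) < eps * Cmod z * Cmod z / 2)%R)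
    by (eapply Rlt_le_trans; [exact Hy | apply Rmin_r]).
  assert (H3 : (Cmod z / 2 < Cmod y)%R).
  { assert (T := Cmod_triangle y (z - y)).
    replace (y + (z - y)) with z in T by ring.
    replace (z - y) with (- (y - z)) in T by ring.
    rewrite Cmod_opp in T. lra. }
  assert (Hy0 : y <> 0) by (apply Cmod_gt_0; lra).
  replace (/ y - / z) with (- ((y - z) / (y * z))) by (field; auto).
  rewrite Cmod_opp, Cmod_div, Cmod_mult by now apply Cmult_neq_0.
  apply Rmult_lt_reg_r with (Cmod y * Cmod z)%R; [apply Rmult_lt_0_compat; lra|].
  replace (Cmod (y - z) / (Cmod y * Cmod z) * (Cmod y * Cmod z))%R
    with (Cmod (y - z)) by (field; lra).
  eapply Rlt_le_trans; [exact H2|].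
  apply Rle_trans with (eps * (Cmod z * (Cmod z / 2)))%R; [right; field|].
  apply Rmult_le_compat_l; [lra|]. rewrite (Rmult_comm (Cmod y)).
  apply Rmult_le_compat_l; lra.
Qed.

Lemma ccont_div (f g : C -> C) (z : C) :
  ccont f z -> ccont g z -> g z <> 0 -> ccont (fun y => f y / g y) z.
Proof.
  intros Hf Hg H. apply ccont_mult; [exact Hf|].
  apply (ccont_comp g Cinv); [exact Hg | now apply ccont_Cinv].
Qed.

Lemma ccont_ext_near (f g : C -> C) (z : C) :
  near z (fun y => f y = g y) -> ccont f z -> ccont g z.
Proof.
  intros He Hf. apply ccont_near. intros eps Heps.
  assert (Hz : f z = g z).
  { destruct He as [d [Hd H]]. apply H.
    replace (z - z) with (RtoC 0) by ring. now rewrite Cmod_0. }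
  apply (near_imp _ (fun y => f y = g y /\ (Cmod (f y - f z) < eps)%R)).
  - intros y [-> H]. now rewrite <- Hz.
  - apply near_and; [exact He|]. now apply ccont_near.
Qed.

Lemma cderiv_near (f : C -> C) (z l : C) :
  cderiv f z l <->
  forall eps : R, (0 < eps)%R ->
    near z (fun y => Cmod (f y - f z - (y - z) * l) <= eps * Cmod (y - z))%R.
Proof.
  split.
  - intros [_ H] eps He.
    specialize (H z (fun P HP => HP) (mkposreal eps He)).
    destruct H as [d H]. exists d. split; [apply cond_pos|].
    intros y Hy. exact (H y Hy).
  - intros H. split.
    + apply is_linear_scal_l.
    + intros x Hx.
      assert (x = z) as ->.
      { symmetry. apply (@is_filter_lim_locally_unique C_AbsRing (AbsRing_NormedModule C_AbsRing)). exact Hx. }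
      intros eps. destruct (H eps (cond_pos eps)) as [d [Hd Hy]].
      exists (mkposreal d Hd). intros y Hyd. exact (Hy y Hyd).
Qed.

(** Caratheodory's form of differentiability: the difference quotient, completed by [l] at [z], is
    continuous there. Product and chain rules become algebraic identities between slopes. *)
Lemma cderiv_slope (f : C -> C) (z l : C) :
  cderiv f z l <->
  exists q : C -> C, ccont q z /\ q z = l /\
    near z (fun y => f y = f z + (y - z) * q y).
Proof.
  rewrite cderiv_near. split.
  - intros H.
    exists (fun y => if Ceq_dec y z then l else (f y - f z) / (y - z)).
    assert (Ez : (if Ceq_dec z z then l else (f z - f z) / (z - z)) = l)
      by (destruct (Ceq_dec z z); congruence).
    split; [|split; [exact Ez|]].
    + apply ccont_near. intros eps He. rewrite Ez.
      apply (near_imp _ (fun y => Cmod (f y - f z - (y - z) * l) <= eps / 2 * Cmod (y - z))%R);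
        [|apply H; lra].
      intros y Hy. destruct (Ceq_dec y z) as [->|Hn].
      * replace (l - l) with (RtoC 0) by ring. now rewrite Cmod_0.
      * assert (Hn' : y - z <> 0).
        { intros E. apply Hn. replace y with (y - z + z) by ring. rewrite E. ring. }
        assert (Hp := proj1 (Cmod_gt_0 _) Hn').
        replace ((f y - f z) / (y - z) - l) with ((f y - f z - (y - z) * l) / (y - z))
          by (field; exact Hn').
        rewrite Cmod_div by exact Hn'.
        apply Rle_lt_trans with (eps / 2)%R; [|lra].
        apply Rmult_le_reg_r with (Cmod (y - z)); [exact Hp|].
        unfold Rdiv at 1. rewrite Rmult_assoc, Rinv_l, Rmult_1_r by lra. exact Hy.
    + exists 1%R. split; [lra|]. intros y _.
      destruct (Ceq_dec y z) as [->|Hn]; [ring|]. field.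
      intros E. apply Hn. replace y with (y - z + z) by ring. rewrite E. ring.
  - intros [q [Hq [Hl Hf]]] eps He.
    apply ccont_near with (eps := eps) in Hq; [|exact He].
    generalize (near_and _ _ _ Hq Hf). apply near_imp.
    intros y [H1 ->].
    replace (f z + (y - z) * q y - f z - (y - z) * l) with ((y - z) * (q y - l)) by ring.
    rewrite Cmod_mult, Rmult_comm. apply Rmult_le_compat_r; [apply Cmod_ge_0|].
    rewrite <- Hl. lra.
Qed.

Lemma cderiv_unique (f : C -> C) (z l1 l2 : C) :
  cderiv f z l1 -> cderiv f z l2 -> l1 = l2.
Proof.
  intros H1 H2. apply is_C_derive_unique in H1. apply is_C_derive_unique in H2.
  congruence.
Qed.

Lemma cderiv_ccont (f : C -> C) (z l : C) : cderiv f z l -> ccont f z.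
Proof.
  intros H. apply cderiv_slope in H. destruct H as [q [Hq [_ Hf]]].
  apply (ccont_ext_near (fun y => f z + (y - z) * q y)).
  - revert Hf. apply near_imp. congruence.
  - apply ccont_plus; [apply ccont_const|]. apply ccont_mult; [|exact Hq].
    apply ccont_minus; [apply ccont_id | apply ccont_const].
Qed.

Lemma cderiv_mult (f g : C -> C) (z l m : C) :
  cderiv f z l -> cderiv g z m -> cderiv (fun y => f y * g y) z (l * g z + f z * m).
Proof.
  intros Hf Hg. assert (Cg := cderiv_ccont _ _ _ Hg).
  apply cderiv_slope in Hf. apply cderiv_slope in Hg. apply cderiv_slope.
  destruct Hf as [q [Hq [<- Hf]]], Hg as [r [Hr [<- Hg]]].
  exists (fun y => q y * g y + f z * r y). split; [|split; [reflexivity|]].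
  - auto using ccont_plus, ccont_mult, ccont_const.
  - generalize (near_and _ _ _ Hf Hg). apply near_imp.
    intros y [-> E]. replace (f z * g z) with (f z * (g y - (y - z) * r y)); [ring|].
    rewrite E. ring.
Qed.

Lemma cderiv_comp (f g : C -> C) (z l m : C) :
  cderiv f z l -> cderiv g (f z) m -> cderiv (fun y => g (f y)) z (m * l).
Proof.
  intros Hf Hg. assert (Cf := cderiv_ccont _ _ _ Hf).
  apply cderiv_slope in Hf. apply cderiv_slope in Hg. apply cderiv_slope.
  destruct Hf as [q [Hq [<- Hf]]], Hg as [r [Hr [<- Hg]]].
  exists (fun y => r (f y) * q y). split; [|split; [reflexivity|]].
  - apply ccont_mult; [|exact Hq]. now apply ccont_comp.
  - generalize (near_and _ _ _ Hf (ccont_preimage _ _ _ Cf Hg)). apply near_imp.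
    intros y [E1 ->]. replace (f y - f z) with ((y - z) * q y) by (rewrite E1; ring).
    ring.
Qed.

Lemma cderiv_ext_near (f g : C -> C) (z l : C) :
  near z (fun y => f y = g y) -> cderiv f z l -> cderiv g z l.
Proof.
  intros He Hf. apply cderiv_slope in Hf. apply cderiv_slope.
  destruct Hf as [q [Hq [<- Hf]]]. exists q. split; [exact Hq|split; [reflexivity|]].
  assert (Hz : f z = g z).
  { destruct He as [d [Hd H]]. apply H.
    replace (z - z) with (RtoC 0) by ring. now rewrite Cmod_0. }
  generalize (near_and _ _ _ He Hf). apply near_imp. intros y [<- ->]. now rewrite Hz.
Qed.

Lemma cderiv_cmul (a z : C) : cderiv (fun y => a * y) z a.
Proof.
  apply cderiv_slope. exists (fun _ => a). split; [apply ccont_const|].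
  split; [reflexivity|]. exists 1%R. split; [lra|]. intros y _. ring.
Qed.

(** * Disk automorphisms and limits of orbits *)

Lemma C_minus_neq_0 (a b : C) : a <> b -> a - b <> 0.
Proof. intros H E. apply H. replace a with (a - b + b) by ring. rewrite E. ring. Qed.

Lemma Cmod_lt_neq_0 (z : C) : (Cmod z < 1)%R -> 1 - z <> 0.
Proof.
  intros H. apply C_minus_neq_0. intros <-. rewrite Cmod_1 in H. lra.
Qed.

(** A full neighbourhood is required because derivatives at boundary points also test points outside
    the closed disk. *)
Lemma near_bfac_den (a p : C) : disk a -> (Cmod p <= 1)%R ->
  near p (fun y => 1 - Cconj a * y <> 0).
Proof.
  unfold disk. intros Ha Hp. exists (1 - Cmod a)%R. split; [lra|].
  intros y Hy. apply Cmod_lt_neq_0. rewrite Cmod_mult, Cmod_conj.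
  assert (T := Cmod_triangle p (y - p)). replace (p + (y - p)) with y in T by ring.
  assert (H0 := Cmod_ge_0 a). assert (H1 := Cmod_ge_0 y). nra.
Qed.

Lemma near_self (z : C) (P : C -> Prop) : near z P -> P z.
Proof.
  intros [d [Hd H]]. apply H. replace (z - z) with (RtoC 0) by ring. now rewrite Cmod_0.
Qed.

Lemma bfac_den (a z : C) : disk a -> (Cmod z <= 1)%R -> 1 - Cconj a * z <> 0.
Proof. intros Ha Hz. exact (near_self _ _ (near_bfac_den a z Ha Hz)). Qed.

Lemma Cmod_bfac_den (a z : C) :
  (Cmod (1 - Cconj a * z) ^ 2 - Cmod (z - a) ^ 2
   = (1 - Cmod a ^ 2) * (1 - Cmod z ^ 2))%R.
Proof. rewrite !Cmod2_alt. destruct a as [a1 a2], z as [z1 z2]. simpl. ring. Qed.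

Lemma Cmod_bfac (a z : C) : 1 - Cconj a * z <> 0 ->
  (Cmod (bfac a z) * Cmod (1 - Cconj a * z) = Cmod (z - a))%R.
Proof.
  intros H. unfold bfac. rewrite Cmod_div by exact H.
  assert (H1 := proj1 (Cmod_gt_0 _) H). field. lra.
Qed.

Lemma one_minus_Cmod_bfac (a z : C) : 1 - Cconj a * z <> 0 ->
  ((1 - Cmod (bfac a z) ^ 2) * Cmod (1 - Cconj a * z) ^ 2
   = (1 - Cmod a ^ 2) * (1 - Cmod z ^ 2))%R.
Proof.
  intros H. rewrite <- Cmod_bfac_den, <- (Cmod_bfac a z H). ring.
Qed.

Lemma disk_sqr (z : C) : disk z <-> (0 < 1 - Cmod z ^ 2)%R.
Proof. unfold disk. assert (H := Cmod_ge_0 z). split; nra. Qed.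

Lemma bfac_disk (a z : C) : disk a -> disk z -> disk (bfac a z).
Proof.
  intros Ha Hz. assert (Hd : 1 - Cconj a * z <> 0) by (apply bfac_den; [|unfold disk in Hz]; auto; lra).
  assert (E := one_minus_Cmod_bfac a z Hd).
  assert (Hp := proj1 (Cmod_gt_0 _) Hd).
  apply disk_sqr. apply disk_sqr in Ha. apply disk_sqr in Hz.
  apply Rmult_lt_reg_r with (Cmod (1 - Cconj a * z) ^ 2)%R; [nra|].
  rewrite E. nra.
Qed.

Lemma disk_mult (y z : C) : disk y -> disk z -> disk (y * z).
Proof.
  unfold disk. rewrite Cmod_mult. intros Hy Hz.
  assert (H0 := Cmod_ge_0 y). assert (H1 := Cmod_ge_0 z). nra.
Qed.

Lemma bfac_minus (a y z : C) : 1 - Cconj a * y <> 0 -> 1 - Cconj a * z <> 0 ->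
  bfac a y - bfac a z
  = (y - z) * ((1 - a * Cconj a) / ((1 - Cconj a * y) * (1 - Cconj a * z))).
Proof. intros Hy Hz. unfold bfac. field. auto. Qed.

Lemma cderiv_bfac (a z : C) : 1 - Cconj a * z <> 0 ->
  cderiv (bfac a) z ((1 - a * Cconj a) / ((1 - Cconj a * z) * (1 - Cconj a * z))).
Proof.
  intros Hz. apply cderiv_slope.
  exists (fun y => (1 - a * Cconj a) / ((1 - Cconj a * y) * (1 - Cconj a * z))).
  assert (Hc : ccont (fun y => 1 - Cconj a * y) z).
  { apply ccont_minus; [apply ccont_const|].
    apply ccont_mult; [apply ccont_const | apply ccont_id]. }
  split; [|split; [reflexivity|]].
  - apply (ccont_div (fun _ => 1 - a * Cconj a) (fun y => (1 - Cconj a * y) * (1 - Cconj a * z))).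
    + apply ccont_const.
    + apply ccont_mult; [exact Hc | apply ccont_const].
    + now apply Cmult_neq_0.
  - generalize (ccont_preimage _ _ _ Hc (near_neq_0 _ Hz)). apply near_imp.
    intros y Hy. rewrite <- bfac_minus by assumption. ring.
Qed.

Lemma ccont_bfac (a z : C) : disk a -> (Cmod z <= 1)%R -> ccont (bfac a) z.
Proof. intros Ha Hz. eapply cderiv_ccont, cderiv_bfac, bfac_den; assumption. Qed.

Lemma Cconj_minus (x y : C) : Cconj (x - y) = Cconj x - Cconj y.
Proof. unfold Cconj, Cminus, Cplus, Copp. simpl. f_equal. ring. Qed.

Lemma Cconj_1 : Cconj 1 = 1.
Proof. unfold Cconj, RtoC. simpl. f_equal. ring. Qed.

Lemma Cconj_neq_0 (z : C) : z <> 0 -> Cconj z <> 0.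
Proof.
  intros H. apply Cmod_gt_0. rewrite Cmod_conj. now apply Cmod_gt_0.
Qed.

Lemma Cconj_bfac_den (a z : C) : Cconj (1 - Cconj a * z) = 1 - a * Cconj z.
Proof. now rewrite Cconj_minus, Cmult_conj, Cconj_conj, Cconj_1. Qed.

Lemma bfac_den_bfac (a y z : C) : 1 - Cconj a * y <> 0 -> 1 - Cconj a * z <> 0 ->
  1 - Cconj (bfac a y) * bfac a z
  = (1 - a * Cconj a) * (1 - Cconj y * z) / ((1 - a * Cconj y) * (1 - Cconj a * z)).
Proof.
  intros Hy Hz. unfold bfac. rewrite Cdiv_conj by exact Hy.
  assert (H := Cconj_neq_0 _ Hy). rewrite Cconj_bfac_den in *.
  rewrite Cconj_minus. field. auto.
Qed.

Lemma disk_1_minus_conj (a : C) : disk a -> 1 - a * Cconj a <> 0.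
Proof.
  intros H. apply Cmod_lt_neq_0. rewrite Cmod_mult, Cmod_conj.
  unfold disk in H. assert (H0 := Cmod_ge_0 a). nra.
Qed.

(** The prefactor is a quotient of conjugates, hence unimodular, so [Cmod (bfac y z)] is invariant:
    it is the pseudo-hyperbolic distance. The prefactor is kept because it enters the rotation [k]
    of the final conjugation. *)
Lemma bfac_bfac (a y z : C) : disk a ->
  1 - Cconj a * y <> 0 -> 1 - Cconj a * z <> 0 -> 1 - Cconj y * z <> 0 ->
  bfac (bfac a y) (bfac a z)
  = (1 - a * Cconj y) / (1 - Cconj a * y) * bfac y z.
Proof.
  intros Ha Hy Hz Hyz. unfold bfac at 1.
  rewrite bfac_minus, bfac_den_bfac by assumption. unfold bfac.
  assert (H := Cconj_neq_0 _ Hy). rewrite Cconj_bfac_den in H.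
  assert (H1 := disk_1_minus_conj _ Ha).
  field. auto.
Qed.

Lemma Cmod_bfac_bfac (a y z : C) : disk a -> disk y -> (Cmod z <= 1)%R ->
  Cmod (bfac (bfac a y) (bfac a z)) = Cmod (bfac y z).
Proof.
  intros Ha Hy Hz.
  assert (H1 : 1 - Cconj a * y <> 0) by (apply bfac_den; [|apply Rlt_le]; assumption).
  rewrite bfac_bfac; auto using bfac_den.
  rewrite Cmod_mult, Cmod_div by exact H1.
  rewrite <- (Cmod_conj (1 - a * Cconj y)), Cconj_minus, Cmult_conj, Cconj_conj, Cconj_1.
  apply Cmod_gt_0 in H1. field. lra.
Qed.

Lemma seq_limit_Cmod (v : nat -> C) (l : C) :
  filterlim v eventually (locally l) <->
  forall eps : R, (0 < eps)%R -> eventually (fun n => Cmod (v n - l) < eps)%R.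
Proof.
  split.
  - intros H eps He. apply (H (fun y => Cmod (y - l) < eps)%R).
    apply locally_C. exists (mkposreal eps He). now intros.
  - intros H P HP. apply locally_C in HP. destruct HP as [d Hd].
    change (eventually (fun n => P (v n))).
    generalize (H d (cond_pos d)). apply filter_imp. intros n Hn. now apply Hd.
Qed.

Lemma seq_limit_ccont (f : C -> C) (v : nat -> C) (l : C) :
  ccont f l -> filterlim v eventually (locally l) ->
  filterlim (fun n => f (v n)) eventually (locally (f l)).
Proof.
  intros Hf Hv. apply seq_limit_Cmod. intros eps He.
  apply (Hv (fun y => Cmod (f y - f l) < eps)%R). apply locally_C.
  apply near_locally. now apply ccont_near.
Qed.

Lemma DW_point_unique (B : C -> C) (z1 z2 : C) :
  DW_point B z1 -> DW_point B z2 -> z1 = z2.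
Proof.
  intros [_ H1] [_ H2].
  assert (D0 : disk 0) by (unfold disk; rewrite Cmod_0; lra).
  exact (filterlim_locally_unique (V := C_R_NormedModule) _ _ _ (H1 _ D0) (H2 _ D0)).
Qed.

Lemma iter_disk (B : C -> C) (z : C) (n : nat) :
  (forall y, disk y -> disk (B y)) -> disk z -> disk (Nat.iter n B z).
Proof. intros HB Hz. induction n; simpl; auto. Qed.

(** * Interior fixed points *)

Definition bsqr (l z : C) : C := bfac l z * bfac l z.

Lemma bsqr_disk (l z : C) : disk l -> disk z -> disk (bsqr l z).
Proof. intros Hl Hz. apply disk_mult; now apply bfac_disk. Qed.

(** Squaring multiplies the pseudo-hyperbolic distance by the explicit factor [Cmod (bfac (- a) z)];
    this is the source of contraction at an interior fixed point. *)
Lemma bfac_sqr (a z : C) : disk a -> disk z ->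
  bfac (a * a) (z * z) = bfac a z * bfac (- a) z.
Proof.
  intros Ha Hz. unfold bfac. rewrite Cmult_conj, Copp_conj.
  assert (H1 := bfac_den a z Ha (Rlt_le _ _ Hz)).
  assert (Ha' : disk (- a)) by (unfold disk; now rewrite Cmod_opp).
  assert (H2 := bfac_den (- a) z Ha' (Rlt_le _ _ Hz)). rewrite Copp_conj in H2.
  assert (H3 := bfac_den _ _ (disk_mult _ _ Ha Ha) (Rlt_le _ _ (disk_mult _ _ Hz Hz))).
  rewrite Cmult_conj in H3.
  field. repeat split; try assumption.
Qed.

Lemma Cmod_1_minus_bounds (a z : C) : (Cmod z <= 1)%R ->
  (1 - Cmod a <= Cmod (1 - Cconj a * z) <= 1 + Cmod a)%R.
Proof.
  intros Hz. assert (H0 := Cmod_ge_0 a). assert (H1 := Cmod_ge_0 z).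
  assert (E : (Cmod (Cconj a * z) <= Cmod a)%R)
    by (rewrite Cmod_mult, Cmod_conj; nra).
  split.
  - assert (T := Cmod_triangle (1 - Cconj a * z) (Cconj a * z)).
    replace (1 - Cconj a * z + Cconj a * z) with (RtoC 1) in T by ring.
    rewrite Cmod_1 in T. lra.
  - assert (T := Cmod_triangle 1 (- (Cconj a * z))).
    rewrite Cmod_1, Cmod_opp in T. unfold Cminus. lra.
Qed.

(** Quantitative Schwarz-Pick: the rate depends on [z] only through the bound [r], so it can be
    iterated along an orbit. *)
Lemma bsqr_contracts (l z0 z : C) (r : R) :
  disk l -> disk z0 -> disk z -> bsqr l z0 = z0 ->
  (Cmod (bfac z0 z) ^ 2 <= r)%R ->
  (Cmod (bfac z0 (bsqr l z)) ^ 2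
   <= (1 - (1 - r) * (1 - Cmod (bfac l z0)) ^ 2 / 4) * Cmod (bfac z0 z) ^ 2)%R.
Proof.
  intros Hl Hz0 Hz Hfix Hr.
  assert (Ha0 := bfac_disk l z0 Hl Hz0). assert (Ha := bfac_disk l z Hl Hz).
  assert (E : Cmod (bfac z0 (bsqr l z))
              = (Cmod (bfac z0 z) * Cmod (bfac (- bfac l z0) (bfac l z)))%R).
  { rewrite <- Hfix at 1. unfold bsqr. rewrite bfac_sqr, Cmod_mult by assumption.
    rewrite Cmod_bfac_bfac; auto. now apply Rlt_le. }
  rewrite E. set (a0 := bfac l z0) in *. set (a := bfac l z) in *.
  rewrite Rpow_mult_distr, Rmult_comm.
  apply Rmult_le_compat_r; [apply pow2_ge_0|].
  assert (Ha0' : disk (- a0)) by (unfold disk; now rewrite Cmod_opp).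
  assert (L := Rlt_le _ _ Ha).
  (* Both identities have the right-hand side (1 - |a0|^2)(1 - |a|^2). Hence 1 - x^2 equals (1 -
     |bfac z0 z|^2) d1^2 / d2^2, where d1 >= 1 - |a0| and d2 <= 2. *)
  assert (E1 := one_minus_Cmod_bfac (- a0) a (bfac_den _ _ Ha0' L)).
  assert (E2 := one_minus_Cmod_bfac a0 a (bfac_den _ _ Ha0 L)).
  assert (Er : Cmod (bfac a0 a) = Cmod (bfac z0 z))
    by (apply Cmod_bfac_bfac; auto; now apply Rlt_le).
  rewrite Er in E2. rewrite Cmod_opp in E1. rewrite <- E2 in E1.
  assert (B1 := Cmod_1_minus_bounds a0 a L).
  assert (B2 := Cmod_1_minus_bounds (- a0) a L).
  rewrite Cmod_opp in B2.
  set (x := Cmod (bfac (- a0) a)) in *.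
  set (d1 := Cmod (1 - Cconj a0 * a)) in *.
  set (d2 := Cmod (1 - Cconj (- a0) * a)) in *.
  assert (H0 := Cmod_ge_0 a0). unfold disk in Ha0, Ha0'.
  assert (D : (0 < d2)%R) by (rewrite Cmod_opp in Ha0'; lra).
  assert (Hrr : (Cmod (bfac z0 z) < 1)%R) by (apply bfac_disk; assumption).
  assert (H5 := Cmod_ge_0 (bfac z0 z)).
  assert (D2 : (d2 ^ 2 <= 4)%R) by nra.
  assert (D1 : ((1 - Cmod a0) ^ 2 <= d1 ^ 2)%R) by nra.
  assert (X : (0 <= 1 - x ^ 2)%R).
  { apply Rmult_le_reg_r with (d2 ^ 2)%R; [nra|]. rewrite E1.
    rewrite Rmult_0_l. apply Rmult_le_pos; nra. }
  assert (((1 - r) * (1 - Cmod a0) ^ 2 <= (1 - x ^ 2) * 4)%R); [|lra].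
  apply Rle_trans with ((1 - x ^ 2) * d2 ^ 2)%R; [|apply Rmult_le_compat_l; lra].
  rewrite E1. apply Rle_trans with ((1 - Cmod (bfac z0 z) ^ 2) * (1 - Cmod a0) ^ 2)%R.
  - apply Rmult_le_compat_r; [nra|lra].
  - apply Rmult_le_compat_l; [nra|lra].
Qed.

Lemma bsqr_interior_fixed_point (l z0 : C) :
  disk l -> disk z0 -> bsqr l z0 = z0 -> DW_point (bsqr l) z0.
Proof.
  intros Hl Hz0 Hfix. split; [now apply Rlt_le|]. intros z Hz.
  set (r := (Cmod (bfac z0 z) ^ 2)%R).
  set (k := (1 - (1 - r) * (1 - Cmod (bfac l z0)) ^ 2 / 4)%R).
  assert (Ha0 : (Cmod (bfac l z0) < 1)%R) by (apply bfac_disk; assumption).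
  assert (Hb : (Cmod (bfac z0 z) < 1)%R) by (apply bfac_disk; assumption).
  assert (H0 := Cmod_ge_0 (bfac l z0)). assert (H1 := Cmod_ge_0 (bfac z0 z)).
  assert (Hr : (0 <= r < 1)%R) by (unfold r; nra).
  assert (Hk : (0 <= k < 1)%R).
  { unfold k.
    assert (P : (0 < (1 - r) * (1 - Cmod (bfac l z0)) ^ 2 <= 1)%R); [|lra].
    assert (0 < (1 - Cmod (bfac l z0)) ^ 2 <= 1)%R by nra.
    split; [apply Rmult_lt_0_compat; lra|nra]. }
  assert (Hn : forall n, disk (Nat.iter n (bsqr l) z)).
  { intros n. apply iter_disk; [|exact Hz]. intros; now apply bsqr_disk. }
  assert (Q : forall n, (Cmod (bfac z0 (Nat.iter n (bsqr l) z)) ^ 2 <= k ^ n * r)%R).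
  { induction n.
    - change (Nat.iter 0 (bsqr l) z) with z. fold r. simpl. lra.
    - change (Nat.iter (S n) (bsqr l) z) with (bsqr l (Nat.iter n (bsqr l) z)).
      assert (Kn : (0 <= k ^ n <= 1)%R).
      { split; [apply pow_le; lra|]. rewrite <- (pow1 n). apply pow_incr. lra. }
      (* The rate computed from the starting point still applies, because k^n r <= r. *)
      eapply Rle_trans; [apply (bsqr_contracts l z0 _ r); auto; nra|].
      fold k. simpl (k ^ S n)%R. rewrite Rmult_assoc.
      apply Rmult_le_compat_l; lra. }
  apply seq_limit_Cmod. intros eps He.
  (* The Euclidean distance is the pseudo-hyperbolic one times a denominator of modulus below 2,
     hence the threshold eps^2 / 4 for the squares. *)
  destruct (pow_lt_1_zero k) with (y := (eps ^ 2 / 4)%R) as [N HN].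
  { rewrite Rabs_pos_eq; lra. } { nra. }
  exists N. intros n Hle. specialize (HN n Hle).
  assert (Kn : (0 <= k ^ n)%R) by (apply pow_le; lra).
  rewrite Rabs_pos_eq in HN by exact Kn.
  specialize (Q n). specialize (Hn n). set (zn := Nat.iter n (bsqr l) z) in *.
  assert (Ln := Rlt_le _ _ Hn).
  rewrite <- (Cmod_bfac z0 zn) by now apply bfac_den.
  assert (B := Cmod_1_minus_bounds z0 zn Ln). unfold disk in Hz0.
  set (x := Cmod (bfac z0 zn)) in *. assert (X : (0 <= x)%R) by apply Cmod_ge_0.
  assert (X2 : (x ^ 2 < (eps / 2) ^ 2)%R) by nra.
  assert (X3 : (x < eps / 2)%R) by nra. nra.
Qed.

(** * Boundary fixed points *)

(* Either [h] is unbounded and [e h <= 1] applies, or [h] converges and its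
   increments control [e]. *)
Lemma growth_forces_zero (h e : nat -> R) (k : R) :
  (0 < k)%R -> (0 < h O)%R -> (forall n, 0 <= e n)%R ->
  (forall n, e n * h n <= 1)%R ->
  (forall n, h n + k * h n * e (S n) <= h (S n))%R ->
  forall eps : R, (0 < eps)%R -> eventually (fun n => e n < eps)%R.
Proof.
  intros Hk H0 He Hb Hg eps Heps.
  assert (Hh : forall n, (h O <= h n)%R /\ (h n <= h (S n))%R).
  { induction n as [|n [I1 I2]].
    - split; [lra|]. assert (A := Hg O). assert (A' := He 1%nat).
      assert (0 <= k * h O * e 1%nat)%R by (repeat apply Rmult_le_pos; lra). lra.
    - split; [lra|]. assert (A := Hg (S n)). assert (A' := He (S (S n))).
      assert (0 <= k * h (S n) * e (S (S n)))%R by (repeat apply Rmult_le_pos; lra). lra. }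
  destruct (classic (exists N, (/ eps < h N)%R)) as [[N HN]|HN].
  - exists N. intros n Hn.
    assert (M : (h N <= h n)%R).
    { induction Hn; [lra|]. destruct (Hh m). lra. }
    assert (P := Rinv_0_lt_compat eps Heps).
    apply Rmult_lt_reg_r with (h n); [lra|].
    apply Rle_lt_trans with 1%R; [apply Hb|].
    rewrite <- (Rinv_r eps) by lra. apply Rmult_lt_compat_l; lra.
  - assert (L : ex_finite_lim_seq h).
    { apply ex_finite_lim_seq_incr with (/ eps)%R; [intros n; apply Hh|].
      intros n. apply Rnot_lt_le. intros A. apply HN. now exists n. }
    destruct L as [l L].
    assert (L1 := proj1 (is_lim_seq_incr_1 h l) L).
    assert (P : (0 < k * h O * eps / 2)%R).
    { apply Rdiv_lt_0_compat; [|lra]. repeat apply Rmult_lt_0_compat; lra. }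
    assert (D := is_lim_seq_minus' _ _ _ _ L1 L). rewrite Rminus_diag in D.
    apply is_lim_seq_spec in D. destruct (D (mkposreal _ P)) as [N HN'].
    (* The growth hypothesis bounds [e] at n + 1 by the increment of [h] from n to n + 1, which
       shifts the index by one. *)
    exists (S N). intros n Hn. destruct n as [|n]; [lia|].
    specialize (HN' n ltac:(lia)). simpl in HN'. rewrite Rminus_0_r in HN'.
    apply Rabs_def2 in HN'. destruct (Hh n) as [I _]. specialize (Hg n).
    specialize (He (S n)).
    assert (k * h O * e (S n) <= k * h n * e (S n))%R.
    { apply Rmult_le_compat_r; [lra|]. apply Rmult_le_compat_l; lra. }
    assert (k * h O * e (S n) < k * h O * eps)%R by lra.
    apply Rmult_lt_reg_l with (k * h O)%R; [apply Rmult_lt_0_compat|]; lra.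
Qed.

Lemma Cmod_bfac_den_unit (l p : C) : Cmod p = 1%R ->
  Cmod (1 - Cconj l * p) = Cmod (p - l).
Proof.
  intros Hp. assert (E := Cmod_bfac_den l p). rewrite Hp in E.
  assert (H0 := Cmod_ge_0 (1 - Cconj l * p)). assert (H1 := Cmod_ge_0 (p - l)). nra.
Qed.

(** The Poisson kernel with pole [p]; its superlevel sets at positive heights are horodisks tangent
    to the circle at [p]. *)
Definition poisson (p z : C) : R := ((1 - Cmod z ^ 2) / Cmod (p - z) ^ 2)%R.

Lemma unit_neq_disk (p z : C) : Cmod p = 1%R -> disk z -> (0 < Cmod (p - z))%R.
Proof.
  intros Hp Hz. apply Cmod_gt_0, C_minus_neq_0. intros ->. unfold disk in Hz. lra.
Qed.

Lemma poisson_pos (p z : C) : Cmod p = 1%R -> disk z -> (0 < poisson p z)%R.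
Proof.
  intros Hp Hz. assert (H := unit_neq_disk p z Hp Hz). apply disk_sqr in Hz.
  apply Rdiv_lt_0_compat; nra.
Qed.

(** The factor (1 - |l|^2) / |p - l|^2 is the modulus of the derivative of [bfac l] at [p]. *)
Lemma poisson_bfac (l p z : C) : disk l -> Cmod p = 1%R -> disk z ->
  (poisson (bfac l p) (bfac l z) * ((1 - Cmod l ^ 2) / Cmod (p - l) ^ 2)
   = poisson p z)%R.
Proof.
  intros Hl Hp Hz. unfold poisson.
  assert (Dp : 1 - Cconj l * p <> 0) by (apply bfac_den; auto; lra).
  assert (Dz : 1 - Cconj l * z <> 0) by (apply bfac_den; auto; now apply Rlt_le).
  rewrite bfac_minus by assumption.
  assert (E := one_minus_Cmod_bfac l z Dz).
  rewrite Cmod_mult, Cmod_div, Cmod_mult, (Cmod_bfac_den_unit l p Hp) by now apply Cmult_neq_0.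
  assert (A1 := unit_neq_disk p z Hp Hz). assert (A2 := unit_neq_disk p l Hp Hl).
  apply Cmod_gt_0 in Dz.
  assert (E2 : Cmod (1 - l * Cconj l) = (1 - Cmod l ^ 2)%R).
  { rewrite <- Cmod2_conj, <- RtoC_minus, Cmod_R. apply Rabs_pos_eq.
    apply disk_sqr in Hl. lra. }
  rewrite E2. apply disk_sqr in Hl.
  replace (1 - Cmod (bfac l z) ^ 2)%R
    with ((1 - Cmod l ^ 2) * (1 - Cmod z ^ 2) / Cmod (1 - Cconj l * z) ^ 2)%R
    by (rewrite <- E; field; lra).
  field. repeat split; lra.
Qed.

Lemma parallelogram (x y : C) :
  (Cmod (x - y) ^ 2 + Cmod (x + y) ^ 2 = 2 * Cmod x ^ 2 + 2 * Cmod y ^ 2)%R.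
Proof. rewrite !Cmod2_alt. destruct x, y. simpl. ring. Qed.

(** Pulling back by the squaring map averages over the two square roots of the pole. After 1 - |a|^4
    and s^2 - a^2 are factored, this is the parallelogram law. *)
Lemma poisson_sqr (s a : C) : Cmod s = 1%R -> disk a ->
  (poisson (s * s) (a * a) = (poisson s a + poisson (- s) a) / 2)%R.
Proof.
  intros Hs Ha. unfold poisson.
  replace (s * s - a * a) with ((s - a) * (s + a)) by ring.
  replace (- s - a) with (- (s + a)) by ring.
  rewrite Cmod_opp, !Cmod_mult.
  assert (A1 := unit_neq_disk s a Hs Ha).
  assert (A2 := unit_neq_disk s (- a) Hs).
  unfold disk in A2. rewrite Cmod_opp in A2. specialize (A2 Ha).
  replace (s - - a) with (s + a) in A2 by ring.
  assert (E := parallelogram s a). rewrite Hs in E.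
  replace (1 - (Cmod a * Cmod a) ^ 2)%R
    with ((1 - Cmod a ^ 2) * ((Cmod (s - a) ^ 2 + Cmod (s + a) ^ 2) / 2))%R
    by (rewrite E; field).
  field. lra.
Qed.

(** Julia's lemma with a gain. With H and U the kernels at [z] and at [a = bfac l z], the derivative
    bound gives H <= U/2, and U/2 is one half of the average in [poisson_sqr]. The other half is at
    least (1 - |a|^2)/8 = U |s - a|^2 / 8; with |s^2 - a^2| <= 2 |s - a| this covers the constant
    1/32. *)
Lemma bsqr_poisson_growth (l s z : C) :
  disk l -> Cmod s = 1%R -> disk z -> bfac l (s * s) = s ->
  (2 * ((1 - Cmod l ^ 2) / Cmod (s * s - l) ^ 2) <= 1)%R ->
  (poisson (s * s) z
   + / 32 * poisson (s * s) z * Cmod (s * s - bsqr l z) ^ 2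
   <= poisson (s * s) (bsqr l z))%R.
Proof.
  intros Hl Hs Hz Hf Hm.
  assert (Hp : Cmod (s * s) = 1%R) by (rewrite Cmod_mult, Hs; ring).
  set (m := ((1 - Cmod l ^ 2) / Cmod (s * s - l) ^ 2)%R) in *.
  assert (Mp : (0 < m)%R).
  { assert (A := unit_neq_disk _ l Hp Hl). apply disk_sqr in Hl.
    apply Rdiv_lt_0_compat; nra. }
  assert (E := poisson_bfac l (s * s) z Hl Hp Hz). rewrite Hf in E. fold m in E.
  assert (Ha := bfac_disk l z Hl Hz). unfold bsqr. set (a := bfac l z) in *.
  rewrite poisson_sqr by assumption.
  assert (Pz := poisson_pos _ z Hp Hz). assert (Pa := poisson_pos _ a Hs Ha).
  set (H := poisson (s * s) z) in *. set (U := poisson s a) in *.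
  assert (UH : (H <= U / 2)%R) by nra.
  assert (A1 := unit_neq_disk s a Hs Ha).
  assert (A2 := unit_neq_disk s (- a) Hs).
  unfold disk in A2, Ha. rewrite Cmod_opp in A2. specialize (A2 Ha).
  replace (s - - a) with (s + a) in A2 by ring.
  assert (V : ((1 - Cmod a ^ 2) / 4 <= poisson (- s) a)%R).
  { unfold poisson. replace (- s - a) with (- (s + a)) by ring. rewrite Cmod_opp.
    apply Rmult_le_compat_l; [assert (B := Cmod_ge_0 a); nra|].
    apply Rinv_le_contravar; [nra|].
    assert (T := Cmod_triangle s a). nra. }
  assert (W : (1 - Cmod a ^ 2 = U * Cmod (s - a) ^ 2)%R)
    by (unfold U, poisson; field; lra).
  replace (s * s - a * a) with ((s - a) * (s + a)) by ring.
  rewrite Cmod_mult.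
  assert (T := Cmod_triangle s a).
  assert (X : ((Cmod (s - a) * Cmod (s + a)) ^ 2 <= Cmod (s - a) ^ 2 * 4)%R).
  { rewrite Rpow_mult_distr. apply Rmult_le_compat_l; nra. }
  assert (Y : (/ 32 * H * (Cmod (s - a) * Cmod (s + a)) ^ 2
              <= / 32 * H * (Cmod (s - a) ^ 2 * 4))%R)
    by (apply Rmult_le_compat_l; lra).
  assert (Z : (H * Cmod (s - a) ^ 2 <= U / 2 * Cmod (s - a) ^ 2)%R)
    by (apply Rmult_le_compat_r; nra).
  assert (N : (0 <= U * Cmod (s - a) ^ 2)%R) by (apply Rmult_le_pos; nra).
  lra.
Qed.

Lemma bsqr_boundary_fixed_point (l s : C) :
  disk l -> Cmod s = 1%R -> bfac l (s * s) = s ->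
  (2 * ((1 - Cmod l ^ 2) / Cmod (s * s - l) ^ 2) <= 1)%R ->
  DW_point (bsqr l) (s * s).
Proof.
  intros Hl Hs Hf Hm.
  assert (Hp : Cmod (s * s) = 1%R) by (rewrite Cmod_mult, Hs; ring).
  split; [lra|]. intros z Hz.
  assert (Hn : forall n, disk (Nat.iter n (bsqr l) z)).
  { intros n. apply iter_disk; [|exact Hz]. intros; now apply bsqr_disk. }
  apply seq_limit_Cmod. intros eps He.
  (* Here [h] is the Poisson kernel along the orbit and [e] the squared distance to the pole; their
     product is 1 - |z_n|^2. *)
  assert (G := growth_forces_zero
    (fun n => poisson (s * s) (Nat.iter n (bsqr l) z))
    (fun n => Cmod (s * s - Nat.iter n (bsqr l) z) ^ 2)%R (/ 32)%R).
  assert (eventually (fun n => Cmod (s * s - Nat.iter n (bsqr l) z) ^ 2 < eps ^ 2)%R) as Q.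
  { apply G.
    - lra.
    - now apply poisson_pos.
    - intros n. apply pow2_ge_0.
    - intros n. unfold poisson.
      assert (A := unit_neq_disk _ _ Hp (Hn n)).
      assert (B := Cmod_ge_0 (Nat.iter n (bsqr l) z)).
      apply Rle_trans with (1 - Cmod (Nat.iter n (bsqr l) z) ^ 2)%R; [right; field; lra|nra].
    - intros n. apply (bsqr_poisson_growth l s (Nat.iter n (bsqr l) z)); auto.
    - now apply pow_lt. }
  revert Q. apply filter_imp. intros n Q.
  replace (Nat.iter n (bsqr l) z - s * s) with (- (s * s - Nat.iter n (bsqr l) z)) by ring.
  rewrite Cmod_opp. assert (B := Cmod_ge_0 (s * s - Nat.iter n (bsqr l) z)). nra.
Qed.

Lemma Cconj_unit (s : C) : Cmod s = 1%R -> s * Cconj s = 1.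
Proof. intros H. rewrite <- Cmod2_conj, H. f_equal. ring. Qed.

(** With p = s^2, the product rule gives 2 s times the derivative of [bfac l] at p. On the circle
    its denominator is p times the conjugate of p - l, and the fixed point equation turns one such
    factor into (p - l)/s, so that only |p - l|^2 is left. *)
Lemma cderiv_bsqr_boundary (l s : C) :
  disk l -> Cmod s = 1%R -> bfac l (s * s) = s ->
  cderiv (bsqr l) (s * s) (RtoC (2 * ((1 - Cmod l ^ 2) / Cmod (s * s - l) ^ 2))).
Proof.
  intros Hl Hs Hf.
  assert (Hp : Cmod (s * s) = 1%R) by (rewrite Cmod_mult, Hs; ring).
  assert (Dp : 1 - Cconj l * (s * s) <> 0) by (apply bfac_den; auto; lra).
  assert (A := unit_neq_disk _ l Hp Hl).
  assert (D := cderiv_bfac l (s * s) Dp).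
  assert (Q := cderiv_mult _ _ _ _ _ D D). rewrite Hf in Q.
  replace (RtoC (2 * ((1 - Cmod l ^ 2) / Cmod (s * s - l) ^ 2))) with
    ((1 - l * Cconj l) / ((1 - Cconj l * (s * s)) * (1 - Cconj l * (s * s))) * s +
      s * ((1 - l * Cconj l) / ((1 - Cconj l * (s * s)) * (1 - Cconj l * (s * s)))));
    [exact Q|].
  rewrite RtoC_mult, RtoC_div, RtoC_minus, !Cmod2_conj by nra.
  assert (N0 : Cconj (s * s - l) <> 0) by (apply Cconj_neq_0, Cmod_gt_0, A).
  assert (N1 : s * s - l <> 0) by (apply Cmod_gt_0, A).
  assert (U := Cconj_unit s Hs).
  assert (E1 : 1 - Cconj l * (s * s) = s * s * Cconj (s * s - l)).
  { rewrite Cconj_minus, Cmult_conj.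
    replace (s * s * (Cconj s * Cconj s - Cconj l))
      with ((s * Cconj s) * (s * Cconj s) - Cconj l * (s * s)) by ring.
    rewrite U. ring. }
  assert (E2 : s * s - l = s * (s * s * Cconj (s * s - l))).
  { rewrite <- E1. rewrite <- Hf at 3. unfold bfac. field. exact Dp. }
  assert (S0 : s <> 0) by (apply Cmod_gt_0; lra).
  rewrite E1. rewrite E2 at 5. field. repeat split; auto.
Qed.

(** * Classification of the squares of Blaschke factors *)

Lemma bsqr_hyperbolic (l s : C) :
  disk l -> Cmod s = 1%R -> bfac l (s * s) = s ->
  (2 * (1 - Cmod l ^ 2) < Cmod (s * s - l) ^ 2)%R -> hyperbolic (bsqr l).
Proof.
  intros Hl Hs Hf Hm.
  assert (Hp : Cmod (s * s) = 1%R) by (rewrite Cmod_mult, Hs; ring).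
  assert (A := unit_neq_disk _ l Hp Hl).
  assert (M : (2 * ((1 - Cmod l ^ 2) / Cmod (s * s - l) ^ 2) < 1)%R).
  { apply Rmult_lt_reg_r with (Cmod (s * s - l) ^ 2)%R; [nra|].
    replace (2 * ((1 - Cmod l ^ 2) / Cmod (s * s - l) ^ 2) * Cmod (s * s - l) ^ 2)%R
      with (2 * (1 - Cmod l ^ 2))%R by (field; lra). lra. }
  exists (s * s). split; [apply bsqr_boundary_fixed_point; auto; lra|].
  split; [exact Hp|]. eexists. split; [now apply cderiv_bsqr_boundary|].
  split; [reflexivity|exact M].
Qed.

Lemma bsqr_parabolic (l s : C) :
  disk l -> Cmod s = 1%R -> bfac l (s * s) = s ->
  (2 * (1 - Cmod l ^ 2) = Cmod (s * s - l) ^ 2)%R -> parabolic (bsqr l).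
Proof.
  intros Hl Hs Hf Hm.
  assert (Hp : Cmod (s * s) = 1%R) by (rewrite Cmod_mult, Hs; ring).
  assert (A := unit_neq_disk _ l Hp Hl).
  assert (M : (2 * ((1 - Cmod l ^ 2) / Cmod (s * s - l) ^ 2) = 1)%R).
  { unfold Rdiv. rewrite <- Rmult_assoc, Hm. field. lra. }
  exists (s * s). split; [apply bsqr_boundary_fixed_point; auto; lra|].
  split; [exact Hp|]. rewrite <- M. now apply cderiv_bsqr_boundary.
Qed.

(* Up to the positive factor [(1 - |l|^2)^2], the discriminant of the cubic
   [(z - l)^2 = z (1 - conj l z)^2] whose roots are the fixed points of [bsqr l]. *)
Definition fixdisc (l : C) : R :=
  (8 * Re l + 1 + 18 * Cmod l ^ 2 - 27 * (Cmod l ^ 2) ^ 2)%R.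

(* With [t = c + i s] on the unit circle, [l = rot3 c s x] for some real [x]
   exactly when [bfac l (t ^ 4) = t ^ 2], so that [bsqr l] fixes [t ^ 4]; its
   derivative there is [2 (c + x) / (c - x)]. *)
Definition rot3 (c s x : R) : C := (c, s) * (c, s) * (c, s) * (x, s).

(** Every [bsqr l] has a fixed point on the circle. For a unit t the condition is that l times the
    cube of conj t has the same imaginary part as t. The intermediate value theorem on the right
    half circle yields t, since at its ends Im t = -1 and 1 outweigh |l| < 1. *)
Lemma boundary_fixed_point_parameter (l : C) : disk l ->
  exists c s x : R, (c ^ 2 + s ^ 2 = 1)%R /\ (0 < c)%R /\
    l = rot3 c s x.
Proof.
  intros Hl. apply disk_sqr in Hl. rewrite Cmod2_alt in Hl.
  destruct l as [a b]. simpl in Hl.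
  (* [tr] and [ti] are the real and imaginary parts of (cos t + i sin t)^3. *)
  set (tr := fun t => (cos t ^ 3 - 3 * cos t * sin t ^ 2)%R).
  set (ti := fun t => (3 * cos t ^ 2 * sin t - sin t ^ 3)%R).
  assert (Cf : continuity (fun t => sin t - (b * tr t - a * ti t))%R) by (unfold tr, ti; reg).
  assert (HP := PI_RGT_0).
  destruct (IVT _ (- (PI / 2)) (PI / 2) Cf) as [t [Ht E]].
  - lra.
  - unfold tr, ti. rewrite cos_neg, sin_neg, cos_PI2, sin_PI2. nra.
  - unfold tr, ti. rewrite cos_PI2, sin_PI2. nra.
  - assert (U : (cos t ^ 2 + sin t ^ 2 = 1)%R)
      by (rewrite <- (sin2_cos2 t); unfold Rsqr; ring).
    assert (C0 : (0 <= cos t)%R) by (apply cos_ge_0; lra).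
    set (x := (a * tr t + b * ti t)%R).
    assert (N : (x ^ 2 + sin t ^ 2 = a ^ 2 + b ^ 2)%R).
    { replace (sin t ^ 2)%R with ((b * tr t - a * ti t) ^ 2)%R by (f_equal; lra).
      unfold x.
      replace ((a * tr t + b * ti t) ^ 2 + (b * tr t - a * ti t) ^ 2)%R
        with ((a ^ 2 + b ^ 2) * (cos t ^ 2 + sin t ^ 2) ^ 3)%R
        by (unfold tr, ti; ring).
      rewrite U. ring. }
    exists (cos t), (sin t), x. split; [exact U|split].
    + destruct (Req_dec (cos t) 0) as [Z|Z]; [|lra].
      exfalso. rewrite Z in U. nra.
    + assert (Es : (sin t = b * tr t - a * ti t)%R) by lra.
      assert (E1 : (a = tr t * x - ti t * sin t)%R).
      { rewrite Es. unfold x.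
        replace (tr t * (a * tr t + b * ti t) - ti t * (b * tr t - a * ti t))%R
          with (a * (cos t ^ 2 + sin t ^ 2) ^ 3)%R by (unfold tr, ti; ring).
        rewrite U. ring. }
      assert (E2 : (b = tr t * sin t + ti t * x)%R).
      { rewrite Es at 1. unfold x.
        replace (tr t * (b * tr t - a * ti t) + ti t * (a * tr t + b * ti t))%R
          with (b * (cos t ^ 2 + sin t ^ 2) ^ 3)%R by (unfold tr, ti; ring).
        rewrite U. ring. }
      unfold rot3, Cmult. simpl. f_equal; [rewrite E1|rewrite E2]; unfold tr, ti; ring.
Qed.

Lemma Cmod_unit_pair (c s : R) : (c ^ 2 + s ^ 2 = 1)%R -> Cmod (c, s) = 1%R.
Proof. intros H. unfold Cmod. simpl fst. simpl snd. rewrite H. apply sqrt_1. Qed.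

Lemma Cmod_rot3 (c s x : R) : (c ^ 2 + s ^ 2 = 1)%R ->
  (Cmod (rot3 c s x) ^ 2 = x ^ 2 + s ^ 2)%R.
Proof.
  intros H. unfold rot3. rewrite !Cmod_mult, (Cmod_unit_pair c s H), !Rmult_1_l.
  apply Cmod2_alt.
Qed.

Lemma rot3_disk (c s x : R) : (c ^ 2 + s ^ 2 = 1)%R -> (0 < c)%R ->
  disk (rot3 c s x) -> (- c < x < c)%R.
Proof.
  intros H Hc Hd. apply disk_sqr in Hd. rewrite Cmod_rot3 in Hd by exact H. split; nra.
Qed.

(** The discriminant of (v - 1) Q(v) is Q(1)^2 times that of Q. Here Q is the quadratic of
    [rot3_fixed], with Q(1) = c + 3x and discriminant (c + x)^2 - 4 (x^2 + s^2). *)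
Lemma fixdisc_rot3 (c s x : R) : (c ^ 2 + s ^ 2 = 1)%R ->
  fixdisc (rot3 c s x) = ((c + 3 * x) ^ 2 * ((c + x) ^ 2 - 4 * (x ^ 2 + s ^ 2)))%R.
Proof.
  intros H. unfold fixdisc. rewrite Cmod_rot3 by exact H.
  assert (E : Re (rot3 c s x)
     = (x * (c ^ 3 - 3 * c * s ^ 2) - 3 * c ^ 2 * s ^ 2 + (s ^ 2) ^ 2)%R)
    by (unfold rot3, Re, Cmult; simpl; ring).
  rewrite E. replace (s ^ 2)%R with (1 - c ^ 2)%R by lra. ring.
Qed.

(* In the unknown [v], where [z = (t ^ 2 v) ^ 2], the fixed point cubic has the
   root [1] coming from [t ^ 4]; the quadratic factor is left. *)
Lemma rot3_fixed (c s x : R) (v : C) :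
  (c ^ 2 + s ^ 2 = 1)%R -> disk (rot3 c s x) -> (Cmod v <= 1)%R ->
  (v - 1) * (Cconj (x, s) * v * v + RtoC (c + x) * v + (x, s)) = 0 ->
  bfac (rot3 c s x) (((c, s) * (c, s) * v) * ((c, s) * (c, s) * v)) = (c, s) * (c, s) * v.
Proof.
  intros H Hd Hv E. assert (Ht := Cmod_unit_pair c s H).
  set (t := (c, s) : C) in *. set (m := (x, s) : C) in *.
  assert (U := Cconj_unit t Ht).
  assert (Ha : (Cmod (t * t * v * (t * t * v)) <= 1)%R).
  { rewrite !Cmod_mult, Ht. assert (V := Cmod_ge_0 v). nra. }
  assert (D := bfac_den _ _ Hd Ha).
  assert (El : Cconj (rot3 c s x) * (t * t * t) = Cconj m).
  { unfold rot3. fold t m. rewrite !Cmult_conj.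
    replace (Cconj t * Cconj t * Cconj t * Cconj m * (t * t * t))
      with ((t * Cconj t) * (t * Cconj t) * (t * Cconj t) * Cconj m) by ring.
    rewrite U. ring. }
  (* Reading c + x both as t + conj m and as conj t + m expands the factored cubic into [E']. *)
  assert (Ek : RtoC (c + x) = t + Cconj m)
    by (unfold t, m, Cconj, Cplus, RtoC; simpl; f_equal; ring).
  assert (Ek' : RtoC (c + x) = Cconj t + m)
    by (unfold t, m, Cconj, Cplus, RtoC; simpl; f_equal; ring).
  assert (E' : Cconj m * v * v * v + t * v * v - Cconj t * v - m = 0).
  { rewrite <- E.
    replace (Cconj m * v * v * v + t * v * v - Cconj t * v - m)
      with (Cconj m * v * v * v + (t + Cconj m - Cconj m) * v * v
            + (m - (Cconj t + m)) * v - m) by ring.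
    rewrite <- Ek, <- Ek'. ring. }
  assert (N : t * t * v * (t * t * v) - rot3 c s x
     = t * t * v * (1 - Cconj (rot3 c s x) * (t * t * v * (t * t * v)))).
  { replace (t * t * v * (1 - Cconj (rot3 c s x) * (t * t * v * (t * t * v))))
      with (t * t * v * (t * Cconj t)
            - (Cconj (rot3 c s x) * (t * t * t)) * (t * t * t) * (v * v * v))
      by (rewrite U; ring).
    rewrite El. unfold rot3. fold t m.
    replace (t * t * v * (t * t * v) - t * t * t * m)
      with (t * t * v * (t * Cconj t) - Cconj m * (t * t * t) * (v * v * v)
            + t * t * t * (Cconj m * v * v * v + t * v * v - Cconj t * v - m)) by ring.
    rewrite E'. ring. }
  unfold bfac. rewrite N. field. exact D.
Qed.

Lemma rot3_dist (c s x : R) (v : C) :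
  (c ^ 2 + s ^ 2 = 1)%R ->
  Cmod (((c, s) * (c, s) * v) * ((c, s) * (c, s) * v) - rot3 c s x)
  = Cmod ((c, s) * v * v - (x, s)).
Proof.
  intros H. assert (Ht := Cmod_unit_pair c s H).
  unfold rot3. set (t := (c, s) : C) in *. set (m := (x, s) : C).
  replace (t * t * v * (t * t * v) - t * t * t * m)
    with (t * t * t * (t * v * v - m)) by ring.
  rewrite !Cmod_mult, Ht. ring.
Qed.

(** Since t = (c + x) - conj m, adding the vanishing quadratic turns t v^2 - m into (c + x) v (v +
    1), and |v + 1|^2 = 2 + 2 Re v on the circle. *)
Lemma rot3_dist_root (c s x : R) (v : C) :
  (c ^ 2 + s ^ 2 = 1)%R -> Cmod v = 1%R ->
  Cconj (x, s) * v * v + RtoC (c + x) * v + (x, s) = 0 ->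
  (Cmod (((c, s) * (c, s) * v) * ((c, s) * (c, s) * v) - rot3 c s x) ^ 2
   = (c + x) ^ 2 * (2 + 2 * Re v))%R.
Proof.
  intros H Hv E. rewrite rot3_dist by exact H.
  assert (Ek : (c, s) = RtoC (c + x) - Cconj (x, s))
    by (unfold Cconj, Cminus, Cplus, Copp, RtoC; simpl; f_equal; ring).
  replace ((c, s) * v * v - (x, s)) with (RtoC (c + x) * v * (v + 1)).
  - rewrite !Cmod_mult, Hv, Cmod_R, Rmult_1_r, Rpow_mult_distr, pow2_abs.
    f_equal. assert (V : (Cmod v ^ 2 = 1)%R) by (rewrite Hv; ring).
    rewrite Cmod2_alt in *. destruct v as [v1 v2]. simpl in *. lra.
  - rewrite Ek.
    replace (RtoC (c + x) * v * (v + 1))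
      with (RtoC (c + x) * v * v - Cconj (x, s) * v * v - (x, s)
            + (Cconj (x, s) * v * v + RtoC (c + x) * v + (x, s))) by ring.
    rewrite E. ring.
Qed.

(** Selects, between the two conjugate choices of square root in the quadratic formula, the one
    whose fixed point has derivative below 1; [boundary_root] shows that the last expression
    measures this. *)
Lemma root_sign (c s x : R) :
  (0 < c + x)%R -> (0 < c + 3 * x)%R ->
  ((c + x) ^ 2 <= 4 * (x ^ 2 + s ^ 2))%R ->
  exists y : R, (4 * y ^ 2 = 4 * (x ^ 2 + s ^ 2) - (c + x) ^ 2)%R /\
    ((c + x) ^ 2 < 4 * (x ^ 2 + s ^ 2) -> 0 < (c + x) * y * s + 2 * x * y ^ 2)%R.
Proof.
  intros Hk H3 Hn. set (k := (c + x)%R) in *.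
  set (n := (x ^ 2 + s ^ 2)%R) in *.
  set (y := sqrt (n - k ^ 2 / 4)).
  assert (Y0 : (0 <= y)%R) by apply sqrt_pos.
  assert (Y2 : (y ^ 2 = n - k ^ 2 / 4)%R) by (apply pow2_sqrt; lra).
  (* The root is given the sign of [s], which makes the first term nonnegative. *)
  assert (Q : exists y', (y' ^ 2 = y ^ 2 /\ y' * s = y * Rabs s)%R).
  { destruct (Rle_dec 0 s).
    - exists y. rewrite Rabs_pos_eq by assumption. lra.
    - exists (- y)%R. rewrite Rabs_left by lra. split; ring. }
  destruct Q as [y' [Q1 Q2]]. exists y'. rewrite Q1, Rmult_assoc, Q2.
  split; [lra|]. intros Hlt.
  assert (Yp : (0 < y)%R) by (apply sqrt_lt_R0; lra).
  assert (R : (0 < k * Rabs s + 2 * x * y)%R).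
  { assert (S2 := pow2_abs s). assert (S0 := Rabs_pos s).
    assert (Np : (0 < n)%R) by nra.
    destruct (Rle_dec 0 x) as [X|X].
    - destruct (Req_dec x 0) as [->|X0].
      + assert (0 < Rabs s)%R; [|nra]. apply Rabs_pos_lt. intros ->. unfold n in Np. lra.
      + assert (0 < x * y)%R by (apply Rmult_lt_0_compat; lra).
        assert (0 <= k * Rabs s)%R by (apply Rmult_le_pos; lra). lra.
    (* For x < 0 the squares are compared: their difference is n (k^2 - 4 x^2), and k^2 - 4 x^2 = (c
       - x)(c + 3x) > 0. *)
    - assert (L : ((2 * - x * y) ^ 2 < (k * Rabs s) ^ 2)%R).
      { rewrite !Rpow_mult_distr, Y2, S2.
        assert (0 < n * (k ^ 2 - 4 * x ^ 2))%R; [|unfold n in *; lra].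
        apply Rmult_lt_0_compat; [lra|]. unfold k. nra. }
      assert (0 <= k * Rabs s)%R by (apply Rmult_le_pos; lra).
      assert (0 < - x * y)%R by (apply Rmult_lt_0_compat; lra).
      assert (2 * - x * y < k * Rabs s)%R; [|lra].
      apply Rnot_le_lt. intros A.
      assert ((k * Rabs s) ^ 2 <= (2 * - x * y) ^ 2)%R by (apply pow_incr; lra). lra. }
  replace (k * (y * Rabs s) + 2 * x * y ^ 2)%R with (y * (k * Rabs s + 2 * x * y))%R by ring.
  now apply Rmult_lt_0_compat.
Qed.

(** The root is v = q / conj m with q^2 + k q + |m|^2 = 0. For a nonpositive discriminant |q| = |m|,
    so v is unimodular. As 1 - |l|^2 = c^2 - x^2, the last two clauses compare the derivative at the
    fixed point with 1. *)
Lemma boundary_root (c s x : R) :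
  (c ^ 2 + s ^ 2 = 1)%R -> (0 < c)%R -> disk (rot3 c s x) -> (0 < c + 3 * x)%R ->
  ((c + x) ^ 2 <= 4 * (x ^ 2 + s ^ 2))%R ->
  exists v : C, Cmod v = 1%R /\
    Cconj (x, s) * v * v + RtoC (c + x) * v + (x, s) = 0 /\
    ((c + x) ^ 2 = 4 * (x ^ 2 + s ^ 2) ->
       2 * (c ^ 2 - x ^ 2) = (c + x) ^ 2 * (2 + 2 * Re v))%R /\
    ((c + x) ^ 2 < 4 * (x ^ 2 + s ^ 2) ->
       2 * (c ^ 2 - x ^ 2) < (c + x) ^ 2 * (2 + 2 * Re v))%R.
Proof.
  intros H Hc Hd H3 Hn. assert (Hx := rot3_disk c s x H Hc Hd).
  destruct (root_sign c s x ltac:(lra) H3 Hn) as [y [Y1 Y2]].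
  set (n := (x ^ 2 + s ^ 2)%R) in *. set (k := (c + x)%R) in *.
  assert (Kp : (0 < k)%R) by (unfold k; lra).
  assert (Np : (0 < n)%R) by nra.
  set (q := (- k / 2, - y)%R : C). set (m := (x, s) : C).
  assert (M2 : (Cmod m ^ 2 = n)%R) by (rewrite Cmod2_alt; unfold n; reflexivity).
  assert (Q2 : (Cmod q ^ 2 = n)%R) by (rewrite Cmod2_alt; simpl; lra).
  assert (M0 : m <> 0).
  { intros E. rewrite E, Cmod_0 in M2. simpl in M2. lra. }
  assert (M0' := Cconj_neq_0 _ M0).
  set (v := q / Cconj m).
  assert (V : (n * Re v = - k * x / 2 + y * s)%R).
  { replace (- k * x / 2 + y * s)%R with (Re (q * m)) by (simpl; unfold Rdiv; ring).
    replace (q * m) with (RtoC n * v); [simpl; ring|].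
    rewrite <- M2, Cmod2_conj. unfold v. field. exact M0'. }
  (* After multiplication by n = |m|^2, the gap between the two sides becomes the expression whose
     sign [root_sign] controls. *)
  assert (D : (n * (k ^ 2 * (2 + 2 * Re v)) - n * (2 * (c ^ 2 - x ^ 2))
              = 2 * k * (k * y * s + 2 * x * y ^ 2))%R).
  { replace (n * (k ^ 2 * (2 + 2 * Re v)))%R
      with (k ^ 2 * (2 * n + 2 * (n * Re v)))%R by ring.
    rewrite V.
    replace (2 * x * y ^ 2)%R with (x / 2 * (4 * y ^ 2))%R by field. rewrite Y1.
    unfold k. field. }
  exists v. split; [|split; [|split]].
  - unfold v. rewrite Cmod_div, Cmod_conj by exact M0'.
    assert (A := Cmod_ge_0 q). assert (A' := proj1 (Cmod_gt_0 m) M0).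
    replace (Cmod q) with (Cmod m) by nra. field. lra.
  - assert (E : q * q + RtoC k * q + m * Cconj m = 0).
    { rewrite <- Cmod2_conj, M2.
      unfold q, Cmult, Cplus, RtoC. simpl. f_equal; [|field].
      replace n with (y ^ 2 + k ^ 2 / 4)%R by lra. field. }
    fold m. unfold v.
    replace (Cconj m * (q / Cconj m) * (q / Cconj m) + k * (q / Cconj m) + m)
      with ((q * q + RtoC k * q + m * Cconj m) / Cconj m) by (field; exact M0').
    rewrite E. unfold Cdiv. ring.
  - intros E. assert (y ^ 2 = 0)%R as Y0 by lra.
    assert (y = 0)%R as Yz by nra. rewrite Yz in D.
    apply Rmult_eq_reg_l with n; [|lra]. lra.
  - intros L. specialize (Y2 L). apply Rmult_lt_reg_l with n; [exact Np|].
    assert (0 < 2 * k * (k * y * s + 2 * x * y ^ 2))%R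
      by (apply Rmult_lt_0_compat; lra). lra.
Qed.

(** The smaller root is taken in rationalized form -2m / (k + g), which stays valid for m = 0; its
    modulus is below 1 since 2 |m| < k. *)
Lemma interior_root (c s x : R) :
  (0 < c + x)%R -> (4 * (x ^ 2 + s ^ 2) < (c + x) ^ 2)%R ->
  exists v : C, (Cmod v < 1)%R /\
    Cconj (x, s) * v * v + RtoC (c + x) * v + (x, s) = 0.
Proof.
  intros Hk Hn. set (k := (c + x)%R) in *. set (m := (x, s) : C).
  assert (M2 : (Cmod m ^ 2 = x ^ 2 + s ^ 2)%R) by (rewrite Cmod2_alt; reflexivity).
  rewrite <- M2 in Hn.
  set (g := sqrt (k ^ 2 - 4 * Cmod m ^ 2)).
  assert (G0 : (0 < g)%R) by (apply sqrt_lt_R0; lra).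
  assert (G2 : (g ^ 2 = k ^ 2 - 4 * Cmod m ^ 2)%R) by (apply pow2_sqrt; lra).
  assert (W : RtoC (k + g) <> 0) by (intros E; apply RtoC_inj in E; lra).
  assert (M0 := Cmod_ge_0 m).
  exists (- (2 * m / RtoC (k + g))). split.
  - rewrite Cmod_opp, Cmod_div, Cmod_mult, !Cmod_R, !Rabs_pos_eq by (auto; lra).
    apply Rmult_lt_reg_r with (k + g)%R; [lra|].
    unfold Rdiv. rewrite Rmult_assoc, Rinv_l, Rmult_1_r, Rmult_1_l by lra. nra.
  - fold m.
    replace (Cconj m * - (2 * m / (k + g)%R) * - (2 * m / (k + g)%R) +
             k * - (2 * m / (k + g)%R) + m)
      with (m * (4 * (m * Cconj m) - RtoC (2 * k * (k + g)) + RtoC ((k + g) * (k + g)))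
            / (RtoC (k + g) * RtoC (k + g)))
      by (rewrite !RtoC_mult; field; exact W).
    rewrite <- Cmod2_conj, <- RtoC_mult, <- RtoC_minus, <- RtoC_plus.
    replace (4 * Cmod m ^ 2 - 2 * k * (k + g) + (k + g) * (k + g))%R with 0%R by lra.
    unfold Cdiv. ring.
Qed.

(** The derivative at the known boundary fixed point is 2 (c + x) / (c - x), which is below, equal
    to or above 1 as c + 3x is negative, zero or positive. In the last case the point is repelling
    and the quadratic factor supplies the Denjoy-Wolff point. *)
Lemma bsqr_classification (l : C) : disk l ->
  (0 < fixdisc l /\ elliptic (bsqr l))%R \/
  (fixdisc l = 0%R /\ parabolic (bsqr l)) \/
  (fixdisc l < 0 /\ hyperbolic (bsqr l))%R.
Proof.
  intros Hl. destruct (boundary_fixed_point_parameter l Hl) as [c [s [x [H [Hc El]]]]].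
  subst l.
  assert (Hx := rot3_disk c s x H Hc Hl).
  assert (N := Cmod_rot3 c s x H).
  rewrite fixdisc_rot3 by exact H.
  assert (Ht := Cmod_unit_pair c s H).
  assert (Hv : forall v, Cmod v = 1%R -> Cmod ((c, s) * (c, s) * v) = 1%R)
    by (intros v Hv; rewrite !Cmod_mult, Ht, Hv; ring).
  assert (F1 : bfac (rot3 c s x) (((c, s) * (c, s) * 1) * ((c, s) * (c, s) * 1))
               = (c, s) * (c, s) * 1).
  { apply rot3_fixed; auto; [rewrite Cmod_1; lra | ring]. }
  assert (D1 : (Cmod (((c, s) * (c, s) * 1) * ((c, s) * (c, s) * 1) - rot3 c s x) ^ 2
                = (c - x) ^ 2)%R).
  { rewrite rot3_dist by exact H. rewrite Cmod2_alt. simpl. ring. }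
  destruct (Rtotal_order (c + 3 * x) 0) as [L|[L|L]].
  - right; right. split.
    + assert (P : (0 < (c + 3 * x) ^ 2)%R) by nra.
      assert ((c + x) ^ 2 - 4 * (x ^ 2 + s ^ 2) < 0)%R; [|nra].
      replace ((c + x) ^ 2 - 4 * (x ^ 2 + s ^ 2))%R
        with ((c + 3 * x) * (c - x) - 4 * s ^ 2)%R by ring.
      assert (0 <= s ^ 2)%R by apply pow2_ge_0. nra.
    + apply (bsqr_hyperbolic _ _ Hl (Hv _ Cmod_1) F1). rewrite D1, N. nra.
  - right; left. split; [rewrite L; ring|].
    apply (bsqr_parabolic _ _ Hl (Hv _ Cmod_1) F1). rewrite D1, N. nra.
  - assert (P : (0 < (c + 3 * x) ^ 2)%R) by nra.
    destruct (Rlt_le_dec (4 * (x ^ 2 + s ^ 2)) ((c + x) ^ 2)) as [G|G].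
    + left. split; [apply Rmult_lt_0_compat; lra|].
      destruct (interior_root c s x ltac:(lra) G) as [v [V1 V2]].
      set (a := (c, s) * (c, s) * v).
      assert (Ha : disk a) by (unfold disk, a; rewrite !Cmod_mult, Ht; lra).
      assert (Fa : bfac (rot3 c s x) (a * a) = a).
      { apply rot3_fixed; auto; [lra|]. rewrite V2. ring. }
      exists (a * a). split; [|now apply disk_mult].
      apply bsqr_interior_fixed_point; auto using disk_mult.
      unfold bsqr. now rewrite Fa.
    + right. destruct (boundary_root c s x H Hc Hl L G) as [v [V1 [V2 [V3 V4]]]].
      assert (Fv : bfac (rot3 c s x) (((c, s) * (c, s) * v) * ((c, s) * (c, s) * v))
               = (c, s) * (c, s) * v).
      { apply rot3_fixed; auto; [lra|]. rewrite V2. ring. }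
      assert (Dv := rot3_dist_root c s x v H V1 V2).
      destruct (Rle_lt_or_eq_dec _ _ G) as [G'|G'].
      * right. split; [nra|].
        apply (bsqr_hyperbolic _ _ Hl (Hv _ V1) Fv). rewrite Dv, N. specialize (V4 G'). lra.
      * left. split; [rewrite G'; ring|].
        apply (bsqr_parabolic _ _ Hl (Hv _ V1) Fv). rewrite Dv, N. specialize (V3 G'). lra.
Qed.

(** * The set [E2] *)

Lemma elliptic_not_parabolic (B : C -> C) : elliptic B -> ~ parabolic B.
Proof.
  intros [z [Hz Dz]] [p [Hp [Up _]]]. rewrite (DW_point_unique B z p Hz Hp) in Dz.
  unfold disk in Dz. lra.
Qed.

Lemma elliptic_not_hyperbolic (B : C -> C) : elliptic B -> ~ hyperbolic B.
Proof.
  intros [z [Hz Dz]] [p [Hp [Up _]]]. rewrite (DW_point_unique B z p Hz Hp) in Dz.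
  unfold disk in Dz. lra.
Qed.

Lemma parabolic_not_hyperbolic (B : C -> C) : parabolic B -> ~ hyperbolic B.
Proof.
  intros [z [Hz [_ Cz]]] [p [Hp [_ [d [Cd [_ Ld]]]]]].
  rewrite <- (DW_point_unique B z p Hz Hp) in Cd.
  rewrite <- (cderiv_unique _ _ _ _ Cz Cd) in Ld. simpl in Ld. lra.
Qed.

Lemma E2_fixdisc (l : C) : E2 l <-> disk l /\ (0 < fixdisc l)%R.
Proof.
  unfold E2. change (fun z => bfac l z * bfac l z) with (bsqr l).
  split; intros [Hl H]; split; auto;
    destruct (bsqr_classification l Hl) as [[F T]|[[F T]|[F T]]]; auto; try lra.
  - now destruct (elliptic_not_parabolic _ H).
  - now destruct (elliptic_not_hyperbolic _ H).
Qed.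

Lemma Cmod_reverse_triangle (y z : C) : (Rabs (Cmod y - Cmod z) <= Cmod (y - z))%R.
Proof.
  assert (T1 := Cmod_triangle z (y - z)). assert (T2 := Cmod_triangle y (z - y)).
  replace (z + (y - z)) with y in T1 by ring. replace (y + (z - y)) with z in T2 by ring.
  replace (z - y) with (- (y - z)) in T2 by ring. rewrite Cmod_opp in T2.
  apply Rabs_le. lra.
Qed.

Lemma continuous_fixdisc (l : C) : @continuous CU R_UniformSpace fixdisc l.
Proof.
  assert (Hr : @continuous CU R_UniformSpace Re l).
  { intros P [e He]. exists e. intros y Hy. apply He.
    eapply Rle_lt_trans; [|exact Hy]. apply (re_le_Cmod (y - l)). }
  assert (Hm : @continuous CU R_UniformSpace Cmod l).
  { intros P [e He]. exists e. intros y Hy. apply He.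
    eapply Rle_lt_trans; [|exact Hy]. apply Cmod_reverse_triangle. }
  assert (Hm2 : @continuous CU R_UniformSpace (fun y => Cmod y ^ 2)%R l).
  { apply (@continuous_ext CU R_UniformSpace (fun y => Cmod y * Cmod y)%R).
    - intros y. simpl. ring.
    - exact (@continuous_mult CU R_AbsRing Cmod Cmod l Hm Hm). }
  apply (@continuous_ext CU R_UniformSpace
    (fun y => (8 * Re y + 1) + (18 * Cmod y ^ 2 + (- 27) * (Cmod y ^ 2 * Cmod y ^ 2)))%R).
  - intros y. match goal with |- ?a = ?b => change (@eq R a b) end. unfold fixdisc. ring.
  - assert (P : forall f g : C -> R, @continuous CU R_UniformSpace f l ->
      @continuous CU R_UniformSpace g l -> @continuous CU R_UniformSpace (fun y => f y + g y)%R l)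
      by (intros f g Cf Cg; exact (@continuous_plus CU R_AbsRing R_NormedModule f g l Cf Cg)).
    assert (M : forall f g : C -> R, @continuous CU R_UniformSpace f l ->
      @continuous CU R_UniformSpace g l -> @continuous CU R_UniformSpace (fun y => f y * g y)%R l)
      by (intros f g Cf Cg; exact (@continuous_mult CU R_AbsRing f g l Cf Cg)).
    assert (K : forall a : R, @continuous CU R_UniformSpace (fun _ => a) l)
      by (intros a; exact (@continuous_const CU R_UniformSpace a l)).
    exact (P _ _ (P _ _ (M _ _ (K 8%R) Hr) (K 1%R))
      (P _ _ (M _ _ (K 18%R) Hm2) (M _ _ (K (- 27)%R) (M _ _ Hm2 Hm2)))).
Qed.

Lemma near_fixdisc_pos (l : C) : (0 < fixdisc l)%R -> near l (fun y => 0 < fixdisc y)%R.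
Proof.
  intros H. apply near_locally. apply (continuous_fixdisc l (fun r => 0 < r)%R).
  exact (open_gt 0 _ H).
Qed.

Lemma near_fixdisc_neg (l : C) : (fixdisc l < 0)%R -> near l (fun y => fixdisc y < 0)%R.
Proof.
  intros H. apply near_locally. apply (continuous_fixdisc l (fun r => r < 0)%R).
  exact (open_lt 0 _ H).
Qed.

(* Rotating [l] keeps [|l|] and increases [Re l]; this is impossible only on the
   real axis, which meets the curve [fixdisc = 0] at its cusp [-1/3]. *)
Lemma fixdisc_zero_limit (l : C) (eps : R) :
  disk l -> fixdisc l = 0%R -> (0 < eps)%R ->
  exists y, disk y /\ (0 < fixdisc y)%R /\ (Cmod (y - l) < eps)%R.
Proof.
  intros Hl Hf He. destruct l as [a b].
  assert (Hd := proj1 (disk_sqr _) Hl). rewrite Cmod2_alt in Hd. simpl in Hd.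
  destruct (Req_dec b 0) as [->|Hb].
  - unfold fixdisc in Hf. rewrite Cmod2_alt in Hf. simpl in Hf.
    (* On the real axis the discriminant factors in this way; inside the disk only the triple zero
       -1/3 remains, and a small step to the right makes it positive. *)
    assert (A : ((1 - a) * (3 * a + 1) ^ 3 = 0)%R) by (rewrite <- Hf; ring).
    apply Rmult_integral in A. destruct A as [A|A]; [nra|].
    assert (A' : (3 * a + 1 = 0)%R).
    { destruct (Req_dec (3 * a + 1) 0) as [Z|Z]; [exact Z|].
      now destruct (pow_nonzero _ 3 Z). }
    set (d := Rmin (eps / 2) (/ 3)).
    assert (D1 : (d <= eps / 2)%R) by apply Rmin_l.
    assert (D2 : (d <= / 3)%R) by apply Rmin_r.
    assert (D0 : (0 < d)%R) by (apply Rmin_pos; lra).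
    exists (RtoC (a + d)). split; [|split].
    + unfold disk. rewrite Cmod_R. apply Rabs_def1; lra.
    + unfold fixdisc. rewrite Cmod_R, pow2_abs. simpl Re.
      replace (8 * (a + d) + 1 + 18 * (a + d) ^ 2 - 27 * ((a + d) ^ 2) ^ 2)%R
        with ((1 - (a + d)) * (3 * (a + d) + 1) ^ 3)%R by ring.
      apply Rmult_lt_0_compat; [lra|]. apply pow_lt. lra.
    + replace (RtoC (a + d) - (a, 0%R)) with (RtoC d)
        by (unfold RtoC, Cminus, Cplus, Copp; simpl; f_equal; ring).
      rewrite Cmod_R, Rabs_pos_eq; lra.
  (* The point is multiplied by [r], the rational parametrization of the circle at [t]. The sign of
     [t] makes Re grow by 2 h b^2 (1 - h a) / (1 + t^2); h <= 1/2 keeps this positive and h <= eps/4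
     keeps |r - 1| <= 2h small. *)
  - set (h := Rmin (/ 2) (eps / 4)).
    assert (H1 : (h <= / 2)%R) by apply Rmin_l.
    assert (H2 : (h <= eps / 4)%R) by apply Rmin_r.
    assert (H0 : (0 < h)%R) by (apply Rmin_pos; lra).
    set (t := (- b * h)%R).
    assert (Pt : (0 < 1 + t ^ 2)%R) by (assert (T := pow2_ge_0 t); lra).
    set (r := ((1 - t ^ 2) / (1 + t ^ 2), 2 * t / (1 + t ^ 2))%R : C).
    assert (Hr : Cmod r = 1%R).
    { apply Cmod_unit_pair. field. lra. }
    assert (Hm : Cmod ((a, b) * r) = Cmod (a, b)) by (rewrite Cmod_mult, Hr; ring).
    exists ((a, b) * r). split; [|split].
    + unfold disk. now rewrite Hm.
    + unfold fixdisc in *. rewrite Hm.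
      assert (E : (Re ((a, b) * r) - a = 2 * h * b ^ 2 * (1 - h * a) / (1 + t ^ 2))%R).
      { unfold r, t. simpl. field. unfold t in Pt. simpl in Pt. lra. }
      assert (0 < 2 * h * b ^ 2 * (1 - h * a) / (1 + t ^ 2))%R; [|simpl Re in *; lra].
      apply Rdiv_lt_0_compat; [|exact Pt].
      assert (0 < b ^ 2)%R by nra.
      apply Rmult_lt_0_compat; [|nra]. apply Rmult_lt_0_compat; lra.
    + replace ((a, b) * r - (a, b)) with ((a, b) * (r - 1)) by ring.
      rewrite Cmod_mult.
      assert (R2 : (Cmod (r - 1) ^ 2 = 4 * t ^ 2 / (1 + t ^ 2))%R).
      { rewrite Cmod2_alt. unfold r. simpl. field. simpl in Pt. lra. }
      assert (T2 : (t ^ 2 <= h ^ 2)%R).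
      { unfold t. rewrite Rpow_mult_distr. replace ((- b) ^ 2)%R with (b ^ 2)%R by ring.
        assert (0 <= b ^ 2 <= 1)%R by nra. assert (0 < h ^ 2)%R by nra. nra. }
      assert (R3 : (Cmod (r - 1) ^ 2 <= (2 * h) ^ 2)%R).
      { rewrite R2. apply Rle_trans with (4 * t ^ 2)%R; [|nra].
        apply Rmult_le_reg_r with (1 + t ^ 2)%R; [exact Pt|].
        unfold Rdiv. rewrite Rmult_assoc, Rinv_l, Rmult_1_r by lra.
        assert (T := pow2_ge_0 t). nra. }
      assert (P := Cmod_ge_0 (r - 1)). assert (P' := Cmod_ge_0 (a, b)).
      assert (R4 : (Cmod (r - 1) <= 2 * h)%R).
      { apply Rnot_lt_le. intros A. nra. }
      unfold disk in Hl. nra.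
Qed.

Lemma rel_boundary_E2 (l : C) : disk l -> (rel_boundary disk E2 l <-> fixdisc l = 0%R).
Proof.
  intros Hl. split.
  - intros [[_ Hc] Hi]. destruct (Rtotal_order (fixdisc l) 0) as [L|[L|L]]; [|exact L|].
    + destruct (near_fixdisc_neg l L) as [d [Hd H]].
      destruct (Hc d Hd) as [y [_ [Ey Dy]]]. specialize (H y Dy).
      apply E2_fixdisc in Ey. lra.
    + destruct Hi. split; [exact Hl|].
      destruct (near_fixdisc_pos l L) as [d [Hd H]]. exists d. split; [exact Hd|].
      intros y Hy Dy. apply E2_fixdisc. auto.
  - intros H0. split.
    + split; [exact Hl|]. intros eps He.
      destruct (fixdisc_zero_limit l eps Hl H0 He) as [y [Y1 [Y2 Y3]]].
      exists y. rewrite E2_fixdisc. auto.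
    + intros [_ [eps [He H]]].
      assert (El : E2 l).
      { apply H; [exact Hl|]. replace (l - l) with (RtoC 0) by ring. now rewrite Cmod_0. }
      apply E2_fixdisc in El. lra.
Qed.

Lemma closureC_E2 (l : C) : disk l -> (closureC E2 l <-> (0 <= fixdisc l)%R).
Proof.
  intros Hl. split.
  - intros Hc. apply Rnot_lt_le. intros L.
    destruct (near_fixdisc_neg l L) as [d [Hd H]].
    destruct (Hc d Hd) as [y [Ey Dy]]. specialize (H y Dy).
    apply E2_fixdisc in Ey. lra.
  - intros H eps He. destruct (Rle_lt_or_eq_dec _ _ H) as [L|L].
    + exists l. split; [apply E2_fixdisc; auto|].
      replace (l - l) with (RtoC 0) by ring. now rewrite Cmod_0.
    + destruct (fixdisc_zero_limit l eps Hl (eq_sym L) He) as [y [Y1 [Y2 Y3]]].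
      exists y. rewrite E2_fixdisc. auto.
Qed.

(** * Conjugation by a disk automorphism *)

Definition dauto (k b z : C) : C := k * bfac b z.
Definition dauto_inv (k b z : C) : C := bfac (- b) (Cconj k * z).

Lemma disk_opp (b : C) : disk b -> disk (- b).
Proof. unfold disk. now rewrite Cmod_opp. Qed.

Lemma bfac_opp_bfac (b z : C) : disk b -> 1 - Cconj b * z <> 0 -> bfac (- b) (bfac b z) = z.
Proof.
  intros Hb Hz. assert (H := disk_1_minus_conj b Hb). unfold bfac. rewrite Copp_conj.
  field. split; [exact Hz|].
  replace (1 - Cconj b * z - - Cconj b * (z - b)) with (1 - b * Cconj b) by ring. exact H.
Qed.

Lemma dauto_invK (k b z : C) : Cmod k = 1%R -> disk b -> 1 - Cconj b * z <> 0 ->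
  dauto_inv k b (dauto k b z) = z.
Proof.
  intros Hk Hb Hz. unfold dauto, dauto_inv.
  replace (Cconj k * (k * bfac b z)) with ((k * Cconj k) * bfac b z) by ring.
  rewrite Cconj_unit, Cmult_1_l by exact Hk. now apply bfac_opp_bfac.
Qed.

Lemma dautoK (k b z : C) : Cmod k = 1%R -> disk b -> (Cmod z <= 1)%R ->
  dauto k b (dauto_inv k b z) = z.
Proof.
  intros Hk Hb Hz. unfold dauto, dauto_inv.
  replace b with (- - b) at 1 by ring. rewrite bfac_opp_bfac.
  - rewrite Cmult_assoc, Cconj_unit by exact Hk. ring.
  - now apply disk_opp.
  - apply bfac_den; [now apply disk_opp|]. rewrite Cmod_mult, Cmod_conj, Hk. lra.
Qed.

Lemma dauto_disk (k b z : C) : Cmod k = 1%R -> disk b -> disk z -> disk (dauto k b z).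
Proof.
  intros Hk Hb Hz. unfold disk, dauto. rewrite Cmod_mult, Hk, Rmult_1_l.
  now apply bfac_disk.
Qed.

Lemma dauto_inv_disk (k b z : C) : Cmod k = 1%R -> disk b -> disk z -> disk (dauto_inv k b z).
Proof.
  intros Hk Hb Hz. apply bfac_disk; [now apply disk_opp|].
  unfold disk. now rewrite Cmod_mult, Cmod_conj, Hk, Rmult_1_l.
Qed.

Lemma bfac_unit (a z : C) : disk a -> Cmod z = 1%R -> Cmod (bfac a z) = 1%R.
Proof.
  intros Ha Hz. assert (D : 1 - Cconj a * z <> 0) by (apply bfac_den; auto; lra).
  assert (E := Cmod_bfac a z D). rewrite <- (Cmod_bfac_den_unit a z Hz) in E.
  apply Cmod_gt_0 in D. nra.
Qed.

Lemma dauto_inv_unit (k b z : C) : Cmod k = 1%R -> disk b -> Cmod z = 1%R ->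
  Cmod (dauto_inv k b z) = 1%R.
Proof.
  intros Hk Hb Hz. apply bfac_unit; [now apply disk_opp|].
  rewrite Cmod_mult, Cmod_conj, Hk, Hz. ring.
Qed.

Lemma ccont_dauto_inv (k b z : C) : Cmod k = 1%R -> disk b -> (Cmod z <= 1)%R ->
  ccont (dauto_inv k b) z.
Proof.
  intros Hk Hb Hz. unfold dauto_inv.
  apply (ccont_comp (fun y => Cconj k * y) (bfac (- b))).
  - apply ccont_mult; [apply ccont_const | apply ccont_id].
  - apply ccont_bfac; [now apply disk_opp|]. rewrite Cmod_mult, Cmod_conj, Hk. lra.
Qed.

Lemma cderiv_id (z : C) : cderiv (fun y => y) z 1.
Proof.
  apply (cderiv_ext_near (fun y => 1 * y)); [|apply cderiv_cmul].
  exists 1%R. split; [lra|]. intros y _. ring.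
Qed.

(** The conjugacy is demanded near every point of the closed disk, so that it also carries
    derivatives at boundary points. *)
Definition dconj (k b : C) (B S : C -> C) : Prop :=
  forall p, (Cmod p <= 1)%R -> near p (fun y => dauto k b (B y) = S (dauto k b y)).

Lemma dconj_DW_point (k b : C) (B S : C -> C) (p : C) :
  Cmod k = 1%R -> disk b -> (forall z, disk z -> disk (B z)) -> dconj k b B S ->
  DW_point S p -> DW_point B (dauto_inv k b p).
Proof.
  intros Hk Hb HB Hc [Hp HS]. split.
  - destruct (Rle_lt_or_eq_dec _ _ Hp) as [L|L].
    + apply Rlt_le, (dauto_inv_disk k b p Hk Hb L).
    + rewrite dauto_inv_unit by assumption. lra.
  - intros z Hz.
    assert (E : forall n, dauto k b (Nat.iter n B z) = Nat.iter n S (dauto k b z)).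
    { induction n; [reflexivity|].
      change (Nat.iter (Datatypes.S n) B z) with (B (Nat.iter n B z)).
      change (Nat.iter (Datatypes.S n) S (dauto k b z)) with (S (Nat.iter n S (dauto k b z))).
      rewrite <- IHn.
      exact (near_self _ _ (Hc _ (Rlt_le _ _ (iter_disk B z n HB Hz)))). }
    apply (filterlim_ext (fun n => dauto_inv k b (Nat.iter n S (dauto k b z)))).
    + intros n. rewrite <- E. apply dauto_invK; auto.
      apply bfac_den; [exact Hb|]. apply Rlt_le, (iter_disk B z n HB Hz).
    + apply seq_limit_ccont; [now apply ccont_dauto_inv|].
      apply HS. now apply dauto_disk.
Qed.

Lemma DW_point_fixed (S : C -> C) (p : C) : DW_point S p -> ccont S p -> S p = p.
Proof.
  intros [_ H] Hc.
  assert (D0 : disk 0) by (unfold disk; rewrite Cmod_0; lra).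
  specialize (H _ D0).
  assert (L1 := seq_limit_ccont _ _ _ Hc H).
  assert (L2 : filterlim (fun n => S (Nat.iter n S 0)) eventually (locally p)).
  { apply seq_limit_Cmod. intros eps He.
    destruct (proj1 (seq_limit_Cmod _ _) H eps He) as [N HN].
    exists N. intros n Hn. apply (HN (Datatypes.S n)). lia. }
  exact (filterlim_locally_unique (V := C_R_NormedModule) _ _ _ L1 L2).
Qed.

(** The multiplier of a fixed point is conjugation invariant: in the chain rule the derivatives of
    [dauto] and [dauto_inv] are inverse to each other. *)
Lemma dconj_cderiv (k b : C) (B S : C -> C) (p d : C) :
  Cmod k = 1%R -> disk b -> dconj k b B S -> (Cmod (dauto_inv k b p) <= 1)%R ->
  ccont B (dauto_inv k b p) -> (Cmod (B (dauto_inv k b p)) <= 1)%R ->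
  (Cmod p <= 1)%R -> S p = p -> cderiv S p d -> cderiv B (dauto_inv k b p) d.
Proof.
  intros Hk Hb Hc Hq HB HBq Hp Hfix HS. set (q := dauto_inv k b p) in *.
  assert (Eq : dauto k b q = p) by (now apply dautoK).
  assert (D1 : exists m, cderiv (dauto k b) q m).
  { eexists. apply (cderiv_comp (bfac b) (fun y => k * y)); [|apply cderiv_cmul].
    apply cderiv_bfac, bfac_den; assumption. }
  assert (D2 : exists n, cderiv (dauto_inv k b) p n).
  { eexists. apply (cderiv_comp (fun y => Cconj k * y) (bfac (- b))); [apply cderiv_cmul|].
    apply cderiv_bfac, bfac_den; [now apply disk_opp|].
    rewrite Cmod_mult, Cmod_conj, Hk. lra. }
  destruct D1 as [m D1], D2 as [n D2].
  assert (NM : n * m = 1).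
  { apply (cderiv_unique (fun y => y) q); [|apply cderiv_id].
    apply (cderiv_ext_near (fun y => dauto_inv k b (dauto k b y))).
    - generalize (near_bfac_den b q Hb Hq). apply near_imp.
      intros y Hy. now apply dauto_invK.
    - apply (cderiv_comp (dauto k b) (dauto_inv k b)); [exact D1|]. now rewrite Eq. }
  apply (cderiv_ext_near (fun y => dauto_inv k b (S (dauto k b y)))).
  - generalize (near_and _ _ _ (Hc q Hq)
      (ccont_preimage _ _ _ HB (near_bfac_den b _ Hb HBq))). apply near_imp.
    intros y [Ey Hy]. rewrite <- Ey. now apply dauto_invK.
  - replace d with (n * (d * m)) by (rewrite <- (Cmult_1_r d) at 2; rewrite <- NM; ring).
    apply (cderiv_comp (fun y => S (dauto k b y)) (dauto_inv k b)).
    + apply (cderiv_comp (dauto k b) S); [exact D1|]. now rewrite Eq.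
    + now rewrite Eq, Hfix.
Qed.

(** * Reduction of a degree two product to a square *)

Lemma Cconj_plus (x y : C) : Cconj (x + y) = Cconj x + Cconj y.
Proof. unfold Cconj, Cplus. simpl. f_equal. ring. Qed.

Lemma Cmod_cis (t : R) : Cmod (cis t) = 1%R.
Proof.
  apply Cmod_unit_pair. rewrite <- (sin2_cos2 t). unfold Rsqr. ring.
Qed.

Lemma cis_plus (a b : R) : cis (a + b) = cis a * cis b.
Proof. unfold cis, Cmult. simpl. rewrite cos_plus, sin_plus. f_equal. ring. Qed.

(** Arguments occur only doubled, as the quotient of z by its conjugate. This makes the branch
    irrelevant and reduces the formula for lambda to rational identities. *)
Lemma polar_conj (z : C) (t : R) :
  z = RtoC (Cmod z) * cis t -> z = cis (2 * t) * Cconj z.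
Proof.
  intros E. rewrite E at 2. rewrite Cmult_conj.
  replace (Cconj (RtoC (Cmod z))) with (RtoC (Cmod z))
    by (unfold Cconj, RtoC; simpl; f_equal; ring).
  replace (2 * t)%R with (t + t)%R by ring. rewrite cis_plus.
  replace (cis t * cis t * (RtoC (Cmod z) * Cconj (cis t)))
    with (RtoC (Cmod z) * cis t * (cis t * Cconj (cis t))) by ring.
  rewrite Cconj_unit, Cmult_1_r by apply Cmod_cis. exact E.
Qed.

Definition crit_num (w u c : C) : C :=
  (1 - w * Cconj w) * (c - u) * (1 - Cconj u * c)
  + (1 - u * Cconj u) * (c - w) * (1 - Cconj w * c).

Lemma cderiv_blaschke (w u z : C) : 1 - Cconj w * z <> 0 -> 1 - Cconj u * z <> 0 ->
  cderiv (fun y => bfac w y * bfac u y) z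
    (crit_num w u z / (((1 - Cconj w * z) * (1 - Cconj u * z))
                       * ((1 - Cconj w * z) * (1 - Cconj u * z)))).
Proof.
  intros Hw Hu. assert (Q := cderiv_mult _ _ _ _ _ (cderiv_bfac w z Hw) (cderiv_bfac u z Hu)).
  eapply eq_ind; [exact Q|]. unfold bfac, crit_num. field. auto.
Qed.

Lemma critical_point_eq (w u c : C) : disk w -> disk u -> disk c ->
  cderiv (fun y => bfac w y * bfac u y) c 0 -> crit_num w u c = 0.
Proof.
  intros Hw Hu Hc H.
  assert (Dw := bfac_den w c Hw (Rlt_le _ _ Hc)).
  assert (Du := bfac_den u c Hu (Rlt_le _ _ Hc)).
  assert (E := cderiv_unique _ _ _ _ H (cderiv_blaschke w u c Dw Du)).
  set (d := (1 - Cconj w * c) * (1 - Cconj u * c)) in *.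
  assert (Dd : d <> 0) by now apply Cmult_neq_0.
  replace (crit_num w u c) with (crit_num w u c / (d * d) * (d * d)) by (field; exact Dd).
  rewrite <- E. ring.
Qed.

(* A degree two product is, up to automorphisms on both sides, the square map. *)
Lemma blaschke_square (w u c z : C) : disk w -> disk u -> disk c ->
  crit_num w u c = 0 ->
  1 - Cconj w * z <> 0 -> 1 - Cconj u * z <> 0 -> 1 - Cconj c * z <> 0 ->
  bfac (bfac w c * bfac u c) (bfac w z * bfac u z)
  = ((1 - Cconj c * w) * (1 - Cconj c * u)) / ((1 - Cconj w * c) * (1 - Cconj u * c))
    * (bfac c z * bfac c z).
Proof.
  intros Hw Hu Hc Hcr Zw Zu Zc.
  assert (Dw := bfac_den w c Hw (Rlt_le _ _ Hc)).
  assert (Du := bfac_den u c Hu (Rlt_le _ _ Hc)).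
  assert (Dw' := Cconj_neq_0 _ Dw). assert (Du' := Cconj_neq_0 _ Du).
  rewrite Cconj_bfac_den in Dw', Du'.
  assert (Hcr' : (1 - w * Cconj w) * (Cconj c - Cconj u) * (1 - u * Cconj c)
    + (1 - u * Cconj u) * (Cconj c - Cconj w) * (1 - w * Cconj c) = 0).
  { assert (E := f_equal Cconj Hcr). unfold crit_num in E.
    rewrite Cconj_plus, !Cmult_conj, !Cconj_minus, !Cmult_conj, !Cconj_conj, !Cconj_1 in E.
    replace (Cconj 0) with (RtoC 0) in E by (unfold Cconj, RtoC; simpl; f_equal; ring).
    rewrite <- E. ring. }
  assert (C1 := disk_1_minus_conj c Hc).
  (* [K] is the leading coefficient in z of the numerator in [E1], and [K'], its conjugate, the
     constant term of the denominator in [E2]. The critical equation makes [K] real, and it cannot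
     vanish since |w u| < 1 and |c| < 1. *)
  set (K := (1 - Cconj w * c) * (1 - Cconj u * c) - Cconj w * Cconj u * (c - w) * (c - u)).
  set (K' := (1 - w * Cconj c) * (1 - u * Cconj c)
             - w * u * (Cconj c - Cconj w) * (Cconj c - Cconj u)).
  assert (KK : K' = K).
  { assert (E : (K' - K) * (1 - c * Cconj c) = Cconj c * crit_num w u c
      - c * ((1 - w * Cconj w) * (Cconj c - Cconj u) * (1 - u * Cconj c)
    + (1 - u * Cconj u) * (Cconj c - Cconj w) * (1 - w * Cconj c)))
      by (unfold K, K', crit_num; ring).
    rewrite Hcr, Hcr' in E.
    replace K' with ((K' - K) * (1 - c * Cconj c) / (1 - c * Cconj c) + K)
      by (field; exact C1).
    rewrite E. field. exact C1. }
  assert (K0 : K <> 0).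
  { intros Z.
    assert (E : (1 - (w * u) * Cconj (w * u)) * (1 - c * Cconj c)
                = K' + c * Cconj c * K - Cconj c * crit_num w u c)
      by (rewrite Cmult_conj; unfold K, K', crit_num; ring).
    rewrite KK, Z, Hcr in E.
    apply (Cmult_neq_0 _ _ (disk_1_minus_conj _ (disk_mult _ _ Hw Hu)) C1).
    rewrite E. ring. }
  set (Dz := (1 - Cconj w * z) * (1 - Cconj u * z)).
  set (Nz := (z - w) * (z - u)).
  set (Dc := (1 - Cconj w * c) * (1 - Cconj u * c)).
  set (Nc := (c - w) * (c - u)).
  set (Dc' := (1 - Cconj c * w) * (1 - Cconj c * u)).
  set (Nc' := (Cconj c - Cconj w) * (Cconj c - Cconj u)).
  (* This quadratic polynomial in z vanishes at c, and to second order because c is critical. *)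
  assert (E1 : Nz * Dc - Nc * Dz = (z - c) * (z - c) * K).
  { transitivity ((z - c) * (z - c) * K + (z - c) * crit_num w u c);
      [unfold Nz, Dc, Nc, Dz, K, crit_num; ring | rewrite Hcr; ring]. }
  (* The mirror image of [E1] under reflection in the circle, obtained from the conjugated critical
     equation. *)
  assert (E2 : Dc' * Dz - Nc' * Nz = (1 - Cconj c * z) * (1 - Cconj c * z) * K).
  { rewrite <- KK.
    transitivity ((1 - Cconj c * z) * (1 - Cconj c * z) * K'
      + z * (1 - Cconj c * z) * ((1 - w * Cconj w) * (Cconj c - Cconj u) * (1 - u * Cconj c)
    + (1 - u * Cconj u) * (Cconj c - Cconj w) * (1 - w * Cconj c)));
      [unfold Nz, Dc', Nc', Dz, K'; ring | rewrite Hcr'; ring]. }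
  assert (DzN : Dz <> 0) by now apply Cmult_neq_0.
  assert (DcN : Dc <> 0) by now apply Cmult_neq_0.
  assert (DcN' : Dc' <> 0).
  { unfold Dc'. rewrite (Cmult_comm (Cconj c) w), (Cmult_comm (Cconj c) u).
    now apply Cmult_neq_0. }
  replace (bfac w c * bfac u c) with (Nc / Dc)
    by (unfold bfac, Nc, Dc; field; auto).
  replace (bfac w z * bfac u z) with (Nz / Dz)
    by (unfold bfac, Nz, Dz; field; auto).
  assert (EC : Cconj (Nc / Dc) = Nc' / Dc').
  { rewrite Cdiv_conj by exact DcN. unfold Nc, Dc, Nc', Dc'.
    rewrite !Cmult_conj, !Cconj_minus, !Cmult_conj, !Cconj_conj, Cconj_1.
    f_equal. ring. }
  assert (E3 : (1 - Cconj c * z) * (1 - Cconj c * z) * K <> 0)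
    by (repeat apply Cmult_neq_0; assumption).
  unfold bfac. rewrite EC.
  replace ((Nz / Dz - Nc / Dc) / (1 - Nc' / Dc' * (Nz / Dz)))
    with ((Dc' / Dc) * ((Nz * Dc - Nc * Dz) / (Dc' * Dz - Nc' * Nz))).
  - rewrite E1, E2. field. auto.
  - field. rewrite E2. auto.
Qed.

Lemma bfac_rotate (k a z : C) : Cmod k = 1%R -> bfac (k * a) (k * z) = k * bfac a z.
Proof.
  intros Hk. unfold bfac. rewrite Cmult_conj.
  replace (Cconj k * Cconj a * (k * z)) with ((k * Cconj k) * (Cconj a * z)) by ring.
  rewrite Cconj_unit, Cmult_1_l by exact Hk. unfold Cdiv. ring.
Qed.

Theorem theorem3p4 :
  forall (u w c : C), disk u -> disk w ->
  (* c is the (unique) critical point of B in D *)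
  disk c -> cderiv (fun z => bfac w z * bfac u z) c (RtoC 0) ->
  (* t1, t2, t3 are arguments of 1 - conj(c) w, 1 - conj(c) u,
     1 - c conj(B(c)) (any branch) *)
  forall t1 t2 t3 : R,
  1 - Cconj c * w = RtoC (Cmod (1 - Cconj c * w)) * cis t1 ->
  1 - Cconj c * u = RtoC (Cmod (1 - Cconj c * u)) * cis t2 ->
  1 - c * Cconj (bfac w c * bfac u c)
    = RtoC (Cmod (1 - c * Cconj (bfac w c * bfac u c))) * cis t3 ->
  let B := fun z => bfac w z * bfac u z in
  let lam := cis (PI + 2 * t1 + 2 * t2 + 2 * t3)%R
             * ((B c - c) / (1 - Cconj c * B c)) in
  (elliptic B <-> E2 lam) /\
  (parabolic B <-> rel_boundary disk E2 lam) /\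
  (hyperbolic B <-> disk lam /\ ~ closureC E2 lam).
Proof.
  intros u w c Hu Hw Hc Hcr t1 t2 t3 H1 H2 H3 B lam.
  apply critical_point_eq in Hcr; try assumption.
  assert (HB : forall z, disk z -> disk (B z))
    by (intros z Hz; apply disk_mult; now apply bfac_disk).
  set (b := B c). change (bfac w c * bfac u c) with b in H3.
  assert (Hb : disk b) by now apply HB.
  assert (Lc := Rlt_le _ _ Hc). assert (Lb := Rlt_le _ _ Hb).
  assert (Dw := bfac_den w c Hw Lc). assert (Du := bfac_den u c Hu Lc).
  assert (Db := bfac_den b c Hb Lc). assert (Db' := bfac_den c b Hc Lb).
  apply polar_conj in H1. apply polar_conj in H2. apply polar_conj in H3.
  rewrite Cconj_bfac_den in H1, H2.
  rewrite (Cmult_comm c (Cconj b)), Cconj_bfac_den in H3.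
  (* By [blaschke_square], [bfac b] after [B] is e times the square of [bfac c], with e = cis(2 t1 +
     2 t2). For psi = k bfac b, the square of [bfac (psi c)] after psi is k^2 cis(-4 t3) times that
     square. Equating this with k e determines k. *)
  set (k := cis (2 * t1 + 2 * t2 + 4 * t3)).
  assert (Hk : Cmod k = 1%R) by apply Cmod_cis.
  assert (Ek : k = cis (2 * t1) * cis (2 * t2) * cis (2 * t3) * cis (2 * t3)).
  { unfold k. rewrite <- !cis_plus. f_equal. ring. }
  assert (N3 : cis (2 * t3) <> 0) by (apply Cmod_gt_0; rewrite Cmod_cis; lra).
  assert (Db3 : 1 - b * Cconj c <> 0) by now rewrite Cmult_comm.
  (* PI accounts for the sign between c - b and b - c, and exchanging 1 - conj b c for its conjugate
     absorbs one factor cis(2 t3). *)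
  assert (El : lam = dauto k b c).
  { unfold lam, dauto, bfac. fold b. rewrite H3, Ek.
    replace (PI + 2 * t1 + 2 * t2 + 2 * t3)%R
      with (PI + (2 * t1 + 2 * t2 + 2 * t3))%R by ring.
    rewrite cis_plus, !cis_plus.
    replace (cis PI) with (RtoC (-1)) by (unfold cis; now rewrite cos_PI, sin_PI).
    rewrite (Cmult_comm (Cconj c) b). field. auto. }
  assert (Dl : disk lam) by (rewrite El; now apply dauto_disk).
  assert (Cj : dconj k b B (bsqr lam)).
  { intros p Hp.
    generalize (near_and _ _ _ (near_and _ _ _ (near_bfac_den w p Hw Hp) (near_bfac_den u p Hu Hp))
      (near_and _ _ _ (near_bfac_den c p Hc Hp) (near_bfac_den b p Hb Hp))).
    apply near_imp. intros y [[Yw Yu] [Yc Yb]].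
    unfold bsqr. rewrite El. unfold dauto.
    rewrite bfac_rotate, bfac_bfac by assumption.
    unfold b at 1, B. rewrite (blaschke_square w u c y) by assumption.
    rewrite H1, H2, H3, Ek, (Cmult_comm c (Cconj w)), (Cmult_comm c (Cconj u)).
    field. auto. }
  assert (TE : elliptic (bsqr lam) -> elliptic B).
  { intros [z [Hz Dz]]. exists (dauto_inv k b z). split; [|now apply dauto_inv_disk].
    now apply (dconj_DW_point k b B (bsqr lam)). }
  assert (TD : forall p d, Cmod p = 1%R -> DW_point (bsqr lam) p ->
            cderiv (bsqr lam) p d -> cderiv B (dauto_inv k b p) d).
  { intros p d Hp HD Hd.
    assert (Uq := dauto_inv_unit k b p Hk Hb Hp).
    apply (dconj_cderiv k b B (bsqr lam)); auto; try lra.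
    - apply ccont_mult; apply ccont_bfac; auto; lra.
    - unfold B. rewrite Cmod_mult, !bfac_unit by assumption. lra.
    - apply DW_point_fixed; [exact HD|]. eapply cderiv_ccont, Hd. }
  assert (TP : parabolic (bsqr lam) -> parabolic B).
  { intros [z [Hz [Uz Cz]]]. exists (dauto_inv k b z).
    split; [now apply (dconj_DW_point k b B (bsqr lam))|].
    split; [now apply dauto_inv_unit | now apply TD]. }
  assert (TH : hyperbolic (bsqr lam) -> hyperbolic B).
  { intros [z [Hz [Uz [d [Cz Ld]]]]]. exists (dauto_inv k b z).
    split; [now apply (dconj_DW_point k b B (bsqr lam))|].
    split; [now apply dauto_inv_unit|]. exists d. split; [now apply TD | exact Ld]. }
  (* Transfer from [bsqr lam] to [B] suffices: the sign of [fixdisc lam] fixes the type of [B], and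
     mutual exclusion of the types yields the converses. *)
  rewrite E2_fixdisc, (rel_boundary_E2 lam Dl), (closureC_E2 lam Dl).
  destruct (bsqr_classification lam Dl) as [[F T]|[[F T]|[F T]]].
  - apply TE in T. assert (X := elliptic_not_parabolic B T).
    assert (Y := elliptic_not_hyperbolic B T).
    repeat split; intros; auto; try tauto; try lra.
  - apply TP in T. assert (Y := parabolic_not_hyperbolic B T).
    assert (X : ~ elliptic B) by (intros A; now apply (elliptic_not_parabolic B A)).
    repeat split; intros; auto; try tauto; try lra.
  - apply TH in T.
    assert (X : ~ elliptic B) by (intros A; now apply (elliptic_not_hyperbolic B A)).
    assert (Y : ~ parabolic B) by (intros A; now apply (parabolic_not_hyperbolic B A)).
    repeat split; intros; auto; try tauto; try lra.
Qed.
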